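(* Let $p \geq 7$ be a prime and let $(r_1, r_2, q)$ be one of the six tuples \[ \left(\tfrac{1}{2}, \tfrac{1}{2}, \tfrac{4}{3}\right), \left(\tfrac{1}{2}, \tfrac{1}{2}, \tfrac{7}{6}\right), \left(\tfrac{1}{2}, \tfrac{1}{3}, \tfrac{7}{6}\right), \left(\tfrac{1}{2}, \tfrac{1}{3}, \tfrac{5}{4}\right), \left(\tfrac{1}{2}, \tfrac{1}{4}, \tfrac{7}{6}\right), \left(\tfrac{1}{2}, \tfrac{1}{2}, \tfrac{5}{4}\right). \] Let $\alpha = \{r_1, 1-r_1, r_2, 1-r_2\}$ and $\beta = \{1,1,q,2-q\}$. Then for all integers $s \geq 0$, \[ p^{s+1} F_{s+1}(\alpha,\beta) \equiv p^s F_s(\alpha,\beta)\cdot pF_1(\alpha,\beta) \pmod{p^3}, \] where the congruence means that the difference of the two sides (rational numbers) has $p$-adic valuation at least $3$.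
   Context: For a rational $a$ and integer $k \ge 0$, $(a)_k = a(a+1)\cdots(a+k-1)$ with $(a)_0=1$. For multisets $\alpha=\{a_1,a_2,a_3,a_4\}$ and $\beta=\{b_1,b_2,b_3,b_4\}$ of rationals and an integer $s \ge 0$, \[F_s(\alpha,\beta) = \sum_{k=0}^{p^s-1} \frac{(a_1)_k(a_2)_k(a_3)_k(a_4)_k}{(b_1)_k(b_2)_k(b_3)_k(b_4)_k}.\] With $\beta=\{1,1,q,2-q\}$ this is the truncation at $p^s-1$ of ${}_4F_3\left[\begin{smallmatrix} r_1 & 1-r_1 & r_2 & 1-r_2\\ & 1 & q & 2-q\end{smallmatrix}; 1\right]$. In particular $F_0(\alpha,\beta)=1$. *)

(* Defs.v *)
From mathcomp Require Import all_boot all_order all_algebra.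
Set Implicit Arguments.
Unset Strict Implicit.
Unset Printing Implicit Defensive.
Import Order.TTheory GRing.Theory Num.Theory.
Local Open Scope ring_scope.

Definition rising (a : rat) (k : nat) : rat := \prod_(i < k) (a + i%:R).

(* A multiset of four rationals is given by any enumeration of it: the
   products below do not depend on the order of the entries. *)
Definition trunc_hyp (p s : nat) (alpha beta : 4.-tuple rat) : rat :=
  \sum_(k < p ^ s)
    (\prod_(a <- alpha) rising a k) / (\prod_(b <- beta) rising b k).

(* Meaningful for x != 0 only: here padic_val p 0 = 0. *)
Definition padic_val (p : nat) (x : rat) : int :=
  (logn p `|numq x|)%:Z - (logn p `|denq x|)%:Z.

(* The disjunct x = y encodes the convention that 0 has infinite valuation. *)
Definition padic_congr (p n : nat) (x y : rat) : Prop :=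
  x = y \/ n%:Z <= padic_val p (x - y).

Definition hyp_params : seq (rat * rat * rat) :=
  [:: (1 / 2, 1 / 2, 4 / 3);
      (1 / 2, 1 / 2, 7 / 6);
      (1 / 2, 1 / 3, 7 / 6);
      (1 / 2, 1 / 3, 5 / 4);
      (1 / 2, 1 / 4, 7 / 6);
      (1 / 2, 1 / 2, 5 / 4)].

(* Main.v *)
Require Import Defs.
From mathcomp Require Import all_boot all_order all_algebra.
From mathcomp Require Import ring lra zify.
Set Implicit Arguments.
Unset Strict Implicit.
Unset Printing Implicit Defensive.
Import Order.TTheory GRing.Theory Num.Theory.
Local Open Scope ring_scope.

(** Write [p = 2m+1], [r = r2], [c = q - 1], and let [t n] be the summand. Choose [J] and [k] with
    [p r - J] in [{r, 1-r}] and [p c - k] in [{1+c, 1-c}]; then [k < J <= m]. Up to a constant,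
    [t n] is [R n] times a product of factors that are [1 + O(p^2)] except at the indices
    [p-1] and [m] modulo [p], where
      [R x = prod_{1<=i<=J} (x+i-pr) prod_{k+2<=i<=m} (x+i-pc) /
             (prod_{0<=j<=J} (x-j+pr) prod_{k+1<=j<=m} (x-j+pc))].
    The exceptional factors rebuild [t b], which gives, modulo [p^3],
      [p t (a+pb) = t b * (pb+pr) (pb+pc) R (a+pb) / (unit)]
    times a factor [1 + p^2 S] with [S mod p] independent of [b], apart from the range [a > m],
    whose contribution is [O(p^3)]. Since [R] has degree [-2], its residues add up to zero, and the
    partial fraction expansion shows that the sum over [a < p] of [(pb+pr) (pb+pc) R (a+pb)] does not
    depend on [b] modulo [p^3]: the remaining terms are harmonic sums over nonzero residues,
    which vanish modulo [p]. Hence each block satisfies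
      [p sum_{a<p} t (a+pb) = t b * (p F_1 + O(p^3) + O(p^3) / (b+1-c))],
    and both [p^s t b] and [p^s t b / (b+1-c)] are [p]-integral for [b < p^s], by induction on [s]
    through the same factorization. *)

(** * Rationals integral at [p] and their reduction to ['F_p] *)

Section PIntegral.
Variables (p : nat) (p_prime : prime p).

(** Meaningful under [pint] only: otherwise the denominator reduces to [0], whose inverse is [0] by
    convention. *)
Definition red (x : rat) : 'F_p := ratr x.
Definition pint (x : rat) : bool := (denq x)%:~R != 0 :> 'F_p.

(** Frees [pint] and [red] from lowest terms. If [p] divided the reduced denominator, cross
    multiplication would make it divide the reduced numerator too, against coprimality. *)
Lemma red_frac (n d : int) : d%:~R != 0 :> 'F_p ->
  pint (n%:~R / d%:~R) /\ red (n%:~R / d%:~R) = n%:~R / d%:~R.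
Proof.
move=> dF; have d0 : d != 0 by apply: contraNneq dF => ->.
set x := n%:~R / d%:~R.
have E : numq x * d = n * denq x.
  apply/eqP; rewrite -(eqr_int rat) !rmorphM /= numqE {1}/x.
  by apply/eqP; field; rewrite intr_eq0.
have EF : (numq x)%:~R * d%:~R = n%:~R * (denq x)%:~R :> 'F_p by rewrite -!intrM E.
have pix : pint x.
  apply/negP => /eqP dx0; move: EF; rewrite dx0 mulr0 => /eqP.
  rewrite mulf_eq0 (negPf dF) orbF => /eqP nx0.
  have := coprime_num_den x; rewrite /coprime => /eqP g1.
  have ch : p \in [pchar 'F_p] := pchar_Fp p_prime.
  have h1 : (p %| `|numq x|)%N.
    by have := dvdz_pcharf ch (numq x); rewrite nx0 eqxx => /idP; rewrite dvdzE.
  have h2 : (p %| `|denq x|)%N.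
    by have := dvdz_pcharf ch (denq x); rewrite dx0 eqxx => /idP; rewrite dvdzE.
  have : (p %| gcdn `|numq x| `|denq x|)%N by rewrite dvdn_gcd h1 h2.
  by rewrite g1 dvdn1 => /eqP p1; move: p_prime; rewrite p1.
split=> //; rewrite /red /ratr; apply/eqP.
by rewrite eqr_div // EF eqxx.
Qed.

Lemma pint_frac x : pint x ->
  exists n d : int, [/\ d%:~R != 0 :> 'F_p, d%:~R != 0 :> rat & x = n%:~R / d%:~R].
Proof.
move=> px; exists (numq x), (denq x); split=> //; first by rewrite intr_eq0 denq_neq0.
by rewrite divq_num_den.
Qed.

Lemma pint_redD x y : pint x -> pint y -> pint (x + y) /\ red (x + y) = red x + red y.
Proof.
move=> /pint_frac [n [d [dF d0 ->]]] /pint_frac [n' [d' [dF' d0' ->]]].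
have -> : n%:~R / d%:~R + n'%:~R / d'%:~R = (n * d' + n' * d)%:~R / (d * d')%:~R :> rat.
  by rewrite intrD !intrM; field; rewrite d0 d0'.
have dd : (d * d')%:~R != 0 :> 'F_p by rewrite intrM mulf_neq0.
have [-> ->] := red_frac (n * d' + n' * d) dd; split=> //.
rewrite (red_frac n dF).2 (red_frac n' dF').2 intrD !intrM.
by rewrite addf_div.
Qed.

Lemma pint_redM x y : pint x -> pint y -> pint (x * y) /\ red (x * y) = red x * red y.
Proof.
move=> /pint_frac [n [d [dF d0 ->]]] /pint_frac [n' [d' [dF' d0' ->]]].
have -> : n%:~R / d%:~R * (n'%:~R / d'%:~R) = (n * n')%:~R / (d * d')%:~R :> rat.
  by rewrite !intrM; field; rewrite d0 d0'.
have dd : (d * d')%:~R != 0 :> 'F_p by rewrite intrM mulf_neq0.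
have [-> ->] := red_frac (n * n') dd; split=> //.
rewrite (red_frac n dF).2 (red_frac n' dF').2 !intrM.
by rewrite mulf_div.
Qed.

Lemma pint_int (n : int) : pint n%:~R.
Proof. by rewrite /pint denq_int oner_eq0. Qed.
Lemma pint_nat (n : nat) : pint n%:R.
Proof. exact: (pint_int n). Qed.
Lemma red_nat (n : nat) : red n%:R = n%:R.
Proof. exact: ratr_nat. Qed.
Lemma pint0 : pint 0. Proof. exact: (pint_nat 0). Qed.
Lemma pint1 : pint 1. Proof. exact: (pint_nat 1). Qed.
Lemma red0 : red 0 = 0. Proof. exact: (red_nat 0). Qed.
Lemma red1 : red 1 = 1. Proof. exact: (red_nat 1). Qed.

Lemma pintD x y : pint x -> pint y -> pint (x + y).
Proof. by move=> px py; case: (pint_redD px py). Qed.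
Lemma redD x y : pint x -> pint y -> red (x + y) = red x + red y.
Proof. by move=> px py; case: (pint_redD px py). Qed.
Lemma pintM x y : pint x -> pint y -> pint (x * y).
Proof. by move=> px py; case: (pint_redM px py). Qed.
Lemma redM x y : pint x -> pint y -> red (x * y) = red x * red y.
Proof. by move=> px py; case: (pint_redM px py). Qed.
Lemma pintN x : pint x -> pint (- x).
Proof. by rewrite /pint denqN. Qed.
Lemma redN x : pint x -> red (- x) = - red x.
Proof.
by move=> px; apply/eqP; rewrite -subr_eq0 opprK -redD ?addNr ?red0 ?pintN.
Qed.
Lemma pintB x y : pint x -> pint y -> pint (x - y).
Proof. by move=> px py; rewrite pintD ?pintN. Qed.
Lemma redB x y : pint x -> pint y -> red (x - y) = red x - red y.
Proof. by move=> px py; rewrite redD ?redN ?pintN. Qed.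

Lemma red_neq0 x : red x != 0 -> x != 0.
Proof. by apply: contraNneq => ->; rewrite red0. Qed.

Lemma pint_redV x : pint x -> red x != 0 -> pint x^-1 /\ red x^-1 = (red x)^-1.
Proof.
move=> /pint_frac [n [d [dF d0 ->]]]; rewrite (red_frac n dF).2 => nd.
have nF : n%:~R != 0 :> 'F_p by apply: contraNneq nd => ->; rewrite mul0r.
rewrite !invf_div; exact: red_frac.
Qed.
Lemma pintV x : pint x -> red x != 0 -> pint x^-1.
Proof. by move=> px rx; case: (pint_redV px rx). Qed.
Lemma redV x : pint x -> red x != 0 -> red x^-1 = (red x)^-1.
Proof. by move=> px rx; case: (pint_redV px rx). Qed.

Lemma pintX x n : pint x -> pint (x ^+ n).
Proof. by move=> px; elim: n => [|n IH]; rewrite ?expr0 ?pint1 // exprS pintM. Qed.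
Lemma redX x n : pint x -> red (x ^+ n) = red x ^+ n.
Proof.
by move=> px; elim: n => [|n IH]; rewrite ?expr0 ?red1 // !exprS redM ?IH ?pintX.
Qed.

Lemma pint_red_sum (I : Type) (s : seq I) (P : pred I) (F : I -> rat) :
  (forall i, P i -> pint (F i)) ->
  pint (\sum_(i <- s | P i) F i) /\
  red (\sum_(i <- s | P i) F i) = \sum_(i <- s | P i) red (F i).
Proof.
move=> H; elim: s => [|i s [IH1 IH2]]; first by rewrite !big_nil pint0 red0.
by rewrite !big_cons; case: ifP => // Pi; rewrite pintD ?redD ?IH2 ?H.
Qed.
Lemma pint_sum (I : Type) (s : seq I) (P : pred I) (F : I -> rat) :
  (forall i, P i -> pint (F i)) -> pint (\sum_(i <- s | P i) F i).
Proof. by case/(pint_red_sum s). Qed.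
Lemma red_sum (I : Type) (s : seq I) (P : pred I) (F : I -> rat) :
  (forall i, P i -> pint (F i)) ->
  red (\sum_(i <- s | P i) F i) = \sum_(i <- s | P i) red (F i).
Proof. by case/(pint_red_sum s). Qed.

Lemma pint_red_prod (I : Type) (s : seq I) (P : pred I) (F : I -> rat) :
  (forall i, P i -> pint (F i)) ->
  pint (\prod_(i <- s | P i) F i) /\
  red (\prod_(i <- s | P i) F i) = \prod_(i <- s | P i) red (F i).
Proof.
move=> H; elim: s => [|i s [IH1 IH2]]; first by rewrite !big_nil pint1 red1.
by rewrite !big_cons; case: ifP => // Pi; rewrite pintM ?redM ?IH2 ?H.
Qed.
Lemma pint_prod (I : Type) (s : seq I) (P : pred I) (F : I -> rat) :
  (forall i, P i -> pint (F i)) -> pint (\prod_(i <- s | P i) F i).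
Proof. by case/(pint_red_prod s). Qed.
Lemma red_prod (I : Type) (s : seq I) (P : pred I) (F : I -> rat) :
  (forall i, P i -> pint (F i)) ->
  red (\prod_(i <- s | P i) F i) = \prod_(i <- s | P i) red (F i).
Proof. by case/(pint_red_prod s). Qed.

Lemma pF0 : p%:R = 0 :> 'F_p.
Proof. by apply/eqP; have := pchar_Fp p_prime; rewrite inE => /andP[]. Qed.
Lemma red_p : red p%:R = 0.
Proof. by rewrite red_nat pF0. Qed.
Lemma pQ_neq0 : p%:R != 0 :> rat.
Proof. by rewrite pnatr_eq0 -lt0n prime_gt0. Qed.

(** Turns a vanishing reduction into a factor [p], which must divide the numerator. *)
Lemma red_dvd x : pint x -> red x = 0 -> pint (x / p%:R).
Proof.
move=> /pint_frac [n [d [dF d0 ->]]]; rewrite (red_frac n dF).2 => /eqP.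
rewrite mulf_eq0 invr_eq0 (negPf dF) orbF => nF.
have : (p %| n)%Z by rewrite (dvdz_pcharf (pchar_Fp p_prime)).
case/dvdzP => k ->; rewrite rmorphM /=.
have -> : k%:~R * p%:~R / d%:~R / p%:R = k%:~R / d%:~R :> rat.
  by field; rewrite d0 pQ_neq0.
exact: (red_frac k dF).1.
Qed.

Lemma natF_eq0 (n : nat) : (n%:R == 0 :> 'F_p) = (p %| n)%N.
Proof. by rewrite -(dvdn_pcharf (pchar_Fp p_prime)). Qed.

Lemma natF_eq (a b : nat) : (a < p)%N -> (b < p)%N -> (a%:R == b%:R :> 'F_p) = (a == b).
Proof.
move=> ap bp; apply/idP/eqP => [|->//].
rewrite -subr_eq0; wlog le : a b ap bp / (b <= a)%N => [th|].
  case/orP: (leq_total b a) => le; first exact: th.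
  by rewrite -opprB oppr_eq0 => h; apply/esym/th.
rewrite -natrB // natF_eq0 => h; apply/eqP; rewrite eqn_leq le andbT.
rewrite -subn_eq0; move: h; rewrite /dvdn modn_small; last exact: leq_ltn_trans (leq_subr _ _) ap.
by [].
Qed.

(** Clear denominators in [z = w p^n] and compare exponents of [p]: the denominator of [w]
    contributes none. *)
Lemma padic_congr_pint n x y : pint ((x - y) / p%:R ^+ n) -> padic_congr p n x y.
Proof.
move=> h; have [->|xy] := eqVneq x y; first by left.
right; set z := x - y in h *; have z0 : z != 0 by rewrite subr_eq0.
set w := z / _ in h; have zE : z = w * p%:R ^+ n by rewrite /w mulfVK // expf_neq0 // pQ_neq0.
have num0 : (0 < `|numq z|)%N by rewrite absz_gt0 numq_eq0.
have E : numq z * denq w = numq w * p%:Z ^+ n * denq z.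
  apply/eqP; rewrite -(eqr_int rat) !rmorphM rmorphXn /= !numqE zE; apply/eqP; ring.
have E' : (`|numq z| * `|denq w| = `|numq w| * p ^ n * `|denq z|)%N.
  have := congr1 absz E; rewrite !abszM => ->; congr (_ * _ * _)%N.
  by rewrite abszX absz_nat.
have dw : logn p `|denq w| = 0%N.
  apply/eqP; rewrite -leqn0 leqNgt logn_gt0 mem_primes p_prime /= absz_gt0 denq_neq0 /=.
  move: h; rewrite /pint -(dvdz_pcharf (pchar_Fp p_prime)) dvdzE; exact.
have w0 : (0 < `|numq w|)%N.
  by rewrite absz_gt0 numq_eq0; apply: contraNneq z0 => w0; rewrite zE w0 mul0r.
have dz0 : (0 < `|denq z|)%N by rewrite absz_gt0 denq_neq0.
have dw0 : (0 < `|denq w|)%N by rewrite absz_gt0 denq_neq0.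
have pn0 : (0 < p ^ n)%N by rewrite expn_gt0 prime_gt0.
have := congr1 (logn p) E'.
rewrite lognM // dw lognM ?muln_gt0 ?w0 // lognM // pfactorK //.
rewrite /padic_val; lia.
Qed.

End PIntegral.

(** * Lagrange interpolation and sums of residues *)

Section PartialFractions.
Variables (F : fieldType) (I : finType) (P : pred I) (z : I -> F) (N : {poly F}).
Hypothesis z_inj : {in P &, injective z}.
Hypothesis N_size : (size N < #|P|)%N.

(** The residue at the simple pole [z i] of [N(t)] divided by the product of all [t - z l]. *)
Definition residue (i : I) : F :=
  N.[z i] / \prod_(l | P l && (l != i)) (z i - z l).

Let L := \sum_(i | P i) residue i *: \prod_(l | P l && (l != i)) ('X - (z l)%:P).

Let size_basis i : P i ->
  size (\prod_(l | P l && (l != i)) ('X - (z l)%:P)) = #|P|.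
Proof.
move=> Pi; rewrite -big_filter size_prod_XsubC.
have -> : #|P| = #|[pred l | P l && (l != i)]|.+1.
  by rewrite (cardD1 i) [i \in _]Pi add1n; congr _.+1; apply: eq_card => l; rewrite !inE andbC.
by rewrite -sum1_size big_filter -sum1_card.
Qed.

(** Lagrange interpolation: [N - L] has degree below [#|P|] and vanishes at the [#|P|] distinct
    nodes. *)
Let N_eq : N = L.
Proof.
apply/eqP; rewrite -subr_eq0; apply/eqP.
apply: (@roots_geq_poly_eq0 _ _ (map z (enum P))).
- apply/allP => _ /mapP [i iP ->]; rewrite mem_enum in iP; rewrite /root !hornerE.
  rewrite /L horner_sum (bigD1 i) //= [X in _ - (_ + X)]big1 => [|j /andP[Pj ji]]; last first.
    rewrite hornerZ horner_prod (bigD1 i) /=; last by rewrite [P i]iP eq_sym.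
    by rewrite hornerXsubC subrr mul0r mulr0.
  rewrite addr0 hornerZ horner_prod /residue.
  under [X in _ - _ / _ * X]eq_bigr do rewrite hornerXsubC.
  rewrite mulfVK ?subrr //; apply/prodf_neq0 => l /andP[Pl li].
  by rewrite subr_eq0; apply: contra_neq li => e; apply/esym/z_inj.
- rewrite map_inj_in_uniq ?enum_uniq // => i j; rewrite !mem_enum; exact: z_inj.
- rewrite size_map -cardE (leq_trans (size_polyD _ _)) // size_polyN geq_max (ltnW N_size) /=.
  apply: (leq_trans (size_sum _ _ _)); apply/bigmax_leqP => i Pi.
  by rewrite (leq_trans (size_scale_leq _ _)) // size_basis.
Qed.

Lemma partial_fractions t : (forall i, P i -> t != z i) ->
  N.[t] / \prod_(i | P i) (t - z i) = \sum_(i | P i) residue i / (t - z i).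
Proof.
move=> tz; rewrite {1}N_eq /L horner_sum mulr_suml; apply: eq_bigr => i Pi.
rewrite hornerZ horner_prod [X in _ / X](bigD1 i) //=.
under eq_bigr do rewrite hornerXsubC.
set Q := \prod_(_ | _) _; have Q0 : Q != 0.
  by apply/prodf_neq0 => l /andP[Pl _]; rewrite subr_eq0 tz.
by rewrite invfM mulrA mulrAC mulfK // mulrC.
Qed.

(** Compare coefficients of degree [#|P| - 1] in the Lagrange form: the basis polynomials are monic
    of that degree, and [N_size] puts [N] below it. *)
Lemma sum_residues : \sum_(i | P i) residue i = 0.
Proof.
have : N`_(#|P|.-1) = 0 by rewrite nth_default // -ltnS prednK // (leq_ltn_trans _ N_size).
rewrite N_eq /L coef_sum => E; rewrite -[RHS]E; apply: eq_bigr => i Pi.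
by rewrite coefZ -(size_basis Pi) -lead_coefE (monicP (monic_prod_XsubC _ _ _)) mulr1.
Qed.

End PartialFractions.

(** * Power sums over ['F_p] and harmonic sums with one term removed *)

Section HarmonicSums.
Variables (p : nat) (p_prime : prime p) (p_gt3 : (3 < p)%N).
Local Notation red := (red p).
Local Notation pint := (pint p).

Lemma sum_ord_Fp (f : 'F_p -> 'F_p) (c : 'F_p) :
  \sum_(a < p) f (a%:R + c) = \sum_x f x.
Proof.
have inj : injective (fun a : 'I_p => a%:R + c : 'F_p).
  move=> a b /addIr/eqP; rewrite natF_eq // => /eqP; exact: val_inj.
rewrite [RHS](reindex (fun a : 'I_p => a%:R + c)) //.
apply: onW_bij; apply: inj_card_bij => //.
by rewrite card_Fp // card_ord.
Qed.

Let two_neq0 : 2%:R != 0 :> 'F_p.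
Proof. by rewrite natF_eq0 // gtnNdvd // (ltn_trans _ p_gt3). Qed.

Let three_neq0 : 3%:R != 0 :> 'F_p.
Proof. by rewrite natF_eq0 // gtnNdvd. Qed.

(* Doubling permutes the field, so each sum is fixed by a factor other than 1. *)
Lemma sum_inv : \sum_(x : 'F_p) x^-1 = 0.
Proof.
have E : \sum_(x : 'F_p) x^-1 = 2%:R^-1 * \sum_(x : 'F_p) x^-1.
  rewrite {1}(reindex (fun x => 2%:R * x)) /=; last first.
    by exists (fun x => 2%:R^-1 * x) => x _; [rewrite mulKf | rewrite mulVKf].
  by rewrite mulr_sumr; apply: eq_bigr => x _; rewrite invfM.
set S := \sum_x _ in E *; have : (2%:R - 1) * S = 0.
  by rewrite mulrBl {1}E mulVKf // mul1r subrr.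
by rewrite -[2%:R]/(1 + 1) addrK mul1r.
Qed.

Lemma sum_inv_sqr : \sum_(x : 'F_p) (x^-1) ^+ 2 = 0.
Proof.
have E : \sum_(x : 'F_p) (x^-1) ^+ 2 = 2%:R^-1 ^+ 2 * \sum_(x : 'F_p) (x^-1) ^+ 2.
  rewrite {1}(reindex (fun x => 2%:R * x)) /=; last first.
    by exists (fun x => 2%:R^-1 * x) => x _; [rewrite mulKf | rewrite mulVKf].
  by rewrite mulr_sumr; apply: eq_bigr => x _; rewrite invfM exprMn.
set S := \sum_x _ in E *; have : (2%:R ^+ 2 - 1) * S = 0.
  by rewrite mulrBl {1}E exprVn mulVKf ?expf_neq0 // mul1r subrr.
have -> : 2%:R ^+ 2 - 1 = 3%:R :> 'F_p by rewrite -natrX (_ : (2 ^ 2 = 3 + 1)%N) // natrD addrK.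
by move/eqP; rewrite mulf_eq0 (negPf three_neq0) => /eqP.
Qed.

(** What is left of the sum of [1/(n - j + p x)] over [n = a + p b], [a < p], once the term [a = j]
    is set aside; then [y = b + x]. *)
Definition shift_inv (j : nat) (y : rat) : rat :=
  \sum_(a < p | a != j :> nat) (a%:R - j%:R + p%:R * y)^-1.

Lemma pint_shift (a j : nat) y : pint y -> pint (a%:R - j%:R + p%:R * y).
Proof. by move=> py; rewrite pintD ?pintB ?pintM ?pint_nat. Qed.

Lemma red_shift (a j : nat) y : pint y -> red (a%:R - j%:R + p%:R * y) = a%:R - j%:R.
Proof.
move=> py; rewrite redD ?pintB ?pintM ?pint_nat // redB ?pint_nat // redM ?pint_nat //.
by rewrite red_p // mul0r addr0 !red_nat.
Qed.

Lemma red_shift_neq0 (a j : nat) y : (a < p)%N -> (j < p)%N -> a != j -> pint y ->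
  red (a%:R - j%:R + p%:R * y) != 0.
Proof. by move=> ap jp aj py; rewrite red_shift // subr_eq0 natF_eq. Qed.

Let shift_neq0 (a j : nat) y : (a < p)%N -> (j < p)%N -> a != j -> pint y ->
  a%:R - j%:R + p%:R * y != 0.
Proof.
move=> ap jp aj py; exact/red_neq0/red_shift_neq0.
Qed.

Let pint_shift_inv_term (j : nat) y (a : 'I_p) : (j < p)%N -> pint y -> a != j :> nat ->
  pint (a%:R - j%:R + p%:R * y)^-1.
Proof. by move=> jp py aj; rewrite pintV ?pint_shift ?red_shift_neq0. Qed.

(** The omitted index is the one with argument [0]. Since [0^-1 = 0] by convention, inverse powers
    satisfy [f 0 = 0]. *)
Let sum_skip (f : 'F_p -> 'F_p) j : (j < p)%N -> f 0 = 0 ->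
  \sum_(a < p | a != j :> nat) f (a%:R - j%:R) = \sum_x f x.
Proof.
move=> jp f0; rewrite -(sum_ord_Fp f (- j%:R)) [RHS](bigD1 (Ordinal jp)) //=.
by rewrite subrr f0 add0r; apply: eq_bigl => a.
Qed.

Lemma pint_shift_inv j y : (j < p)%N -> pint y -> pint (shift_inv j y).
Proof. by move=> jp py; apply: pint_sum => // a aj; apply: pint_shift_inv_term. Qed.

Lemma red_shift_inv j y : (j < p)%N -> pint y -> red (shift_inv j y) = 0.
Proof.
move=> jp py; rewrite /shift_inv red_sum //; last first.
  by move=> a aj; apply: pint_shift_inv_term.
rewrite -[RHS]sum_inv -(@sum_skip (fun x => x^-1) _ jp (invr0 _)); apply: eq_bigr => a aj.
by rewrite redV ?red_shift ?pint_shift // subr_eq0 natF_eq.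
Qed.

(** One factor [p] comes from [1/u - 1/v = (v - u)/(uv)] with [v - u = p (y' - y)]; the other
    because the sum of the [1/(uv)] reduces to the sum of inverse squares, which is zero. *)
Lemma shift_inv_diff j y y' : (j < p)%N -> pint y -> pint y' ->
  exists2 w, pint w & shift_inv j y - shift_inv j y' = p%:R ^+ 2 * w.
Proof.
move=> jp py py'.
pose w a := (a%:R - j%:R + p%:R * y)^-1 * (a%:R - j%:R + p%:R * y')^-1.
have pw (a : 'I_p) : a != j :> nat -> pint (w a).
  by move=> aj; rewrite pintM ?pint_shift_inv_term.
pose W := \sum_(a < p | a != j :> nat) w a.
have E : shift_inv j y - shift_inv j y' = p%:R * ((y' - y) * W).
  rewrite /shift_inv -sumrB /W !mulr_sumr; apply: eq_bigr => a aj.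
  by rewrite /w; field; rewrite !shift_neq0.
have rW : red W = 0.
  rewrite /W red_sum // -[RHS]sum_inv_sqr -(@sum_skip (fun x => x^-1 ^+ 2) _ jp); last first.
    by rewrite invr0 expr0n.
  apply: eq_bigr => a aj; rewrite /w redM ?pint_shift_inv_term //.
  by rewrite !redV ?red_shift ?pint_shift ?expr2 // subr_eq0 natF_eq.
exists ((y' - y) * (W / p%:R)).
  by rewrite pintM ?pintB // red_dvd // pint_sum.
by rewrite E; field; rewrite pQ_neq0.
Qed.

End HarmonicSums.

(** * Shifted products and nonvanishing of non-integers *)

Lemma risingS a n : rising a n.+1 = rising a n * (a + n%:R).
Proof. by rewrite /rising big_ord_recr. Qed.

Lemma rising_shift a n : rising (a + 1) n * a = rising a n * (a + n%:R).
Proof.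
elim: n => [|n IH]; first by rewrite /rising !big_ord0; ring.
rewrite !risingS -mulrA [(_ + _) * a]mulrC mulrA IH -natr1; ring.
Qed.

(** The factors at [z + 1] are those at [z] with the index moved by one, so only the two end factors
    fail to match. *)
Lemma prod_nat_shift (F : comPzRingType) (z : F) (f f' : nat -> F) lo hi :
  (lo <= hi)%N -> (forall j, f j = z - j%:R) -> (forall j, f' j = z + 1 - j%:R) ->
  \prod_(lo <= j < hi) f' j * (z + 1 - hi%:R) =
  (z + 1 - lo%:R) * \prod_(lo <= j < hi) f j.
Proof.
move=> /subnKC <- fE f'E; elim: (hi - lo)%N => [|n IH].
  by rewrite addn0 !big_geq // mul1r mulr1.
rewrite addnS !big_nat_recr ?leq_addr //= fE f'E -natr1 mulrAC mulrA -IH; ring.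
Qed.

Lemma big_ord_range (R : Type) (idx : R) (op : Monoid.law idx) p lo hi (f : nat -> R) :
  (hi <= p)%N ->
  \big[op/idx]_(j < p | (lo <= j < hi)%N) f j = \big[op/idx]_(lo <= j < hi) f j.
Proof.
move=> hp; rewrite big_geq_mkord (big_ord_widen_cond p (fun j => lo <= j)%N f hp).
by [].
Qed.

Lemma int_add_frac_neq0 (z : int) (x : rat) : 0 < x < 1 -> z%:~R + x != 0.
Proof.
case/andP=> x0 x1; apply/eqP => e.
have h1 : z%:~R < 0 :> rat by lra.
have h2 : (-1)%:~R < z%:~R :> rat by rewrite rmorphN /=; lra.
by move: h1 h2; rewrite ltrz0 ltr_int; lia.
Qed.

Lemma int_sub_frac_neq0 (z : int) (x : rat) : 0 < x < 1 -> z%:~R - x != 0.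
Proof.
by move=> x01; rewrite -oppr_eq0 opprB addrC -rmorphN int_add_frac_neq0.
Qed.

(** * The summand compared with a rational function *)

Section Summand.
Variables (p m J k : nat) (r c : rat).
Hypothesis p_odd : p = m.*2.+1.
Hypothesis k_lt_J : (k < J)%N.
Hypothesis J_le_m : (J <= m)%N.
Hypothesis k2_le_m : (k.+2 <= m)%N.
Hypothesis r01 : 0 < r < 1.
Hypothesis c01 : 0 < c < 1.
Hypothesis rJ : p%:R * r - J%:R = r \/ p%:R * r - J%:R = 1 - r.
Hypothesis ck : p%:R * c - k%:R = 1 + c \/ p%:R * c - k%:R = 1 - c.

Ltac clear_rational := repeat match goal with
  | H : context [r] |- _ => clear H
  | H : context [c] |- _ => clear H
  | H : context [Zp_trunc] |- _ => clear H
  | H : context [@Algebra.natmul] |- _ => clear H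
  end.
Ltac nat_lia := clear_rational; lia.
Ltac nat_nia := clear_rational; nia.

Definition term (n : nat) : rat :=
  (rising (1 / 2) n * rising (1 / 2) n * rising r n * rising (1 - r) n) /
  (rising 1 n * rising 1 n * rising (1 + c) n * rising (1 - c) n).

Definition numer (t : rat) : rat :=
  rising (t + 1 - p%:R * r) J * rising (t + k.+2%:R - p%:R * c) (m - k.+1).
(** Indexed by all [j < p] under a condition, so that the factor [j = a] can be singled out and the
    poles form a subset of a finite type. *)
Definition denA (t : rat) : rat :=
  \prod_(j < p | (j < J.+1)%N) (t - j%:R + p%:R * r).
Definition denB (t : rat) : rat :=
  \prod_(j < p | (k < j < m.+1)%N) (t - j%:R + p%:R * c).
Definition ratfun (t : rat) : rat := numer t / (denA t * denB t).

(** The quotient [error_factor n] with its numerator or denominator replaced by [1] where [p]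
    divides [n + 1] or [2n + 1]: there [p^2] cancels and the factor need not be close to [1]. *)
Definition unit_factor (n : nat) : rat :=
  (if (p %| n.+1)%N then 1 else 1 - p%:R ^+ 2 * r ^+ 2 / n.+1%:R ^+ 2) /
  (if (p %| n.*2.+1)%N then 1
   else 1 - p%:R ^+ 2 * (1 / 2 - c) ^+ 2 / (n%:R + 1 / 2) ^+ 2).
Definition unit_part (n : nat) : rat := \prod_(i < n) unit_factor i.

(** The contribution of the exceptional index [m + b p] to the product of error factors; it is
    included only once [a > m]. *)
Definition excess (a b : nat) : rat :=
  if (a <= m)%N then 1 else (b%:R + 1 / 2) ^+ 2 / ((b%:R + c) * (b%:R + 1 - c)).

(** The growth of [term] from [n] to [n + 1] divided by the growth of [ratfun]. *)
Definition error_factor (n : nat) : rat :=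
  (n%:R + 1 / 2) ^+ 2 * (n.+1%:R ^+ 2 - p%:R ^+ 2 * r ^+ 2) /
  (((n%:R + 1 / 2) ^+ 2 - p%:R ^+ 2 * (1 / 2 - c) ^+ 2) * n.+1%:R ^+ 2).

Let pE : p%:R = 2%:R * m%:R + 1 :> rat.
Proof. by rewrite p_odd -muln2 -natr1 natrM mulrC. Qed.

Let p_neq0 : p%:R != 0 :> rat.
Proof. by rewrite p_odd pnatr_eq0. Qed.

(** By [rJ], [p r] is an integer plus or minus [r], and [0 < r < 1]. *)
Lemma int_add_pr_neq0 (z : int) : z%:~R + p%:R * r != 0.
Proof.
case: rJ => h.
  have -> : z%:~R + p%:R * r = (z + J%:Z)%:~R + r by rewrite rmorphD /=; lra.
  exact: int_add_frac_neq0.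
have -> : z%:~R + p%:R * r = (z + J%:Z + 1)%:~R - r by rewrite !rmorphD /=; lra.
exact: int_sub_frac_neq0.
Qed.

Lemma int_add_pc_neq0 (z : int) : z%:~R + p%:R * c != 0.
Proof.
case: ck => h.
  have -> : z%:~R + p%:R * c = (z + k%:Z + 1)%:~R + c by rewrite !rmorphD /=; lra.
  exact: int_add_frac_neq0.
have -> : z%:~R + p%:R * c = (z + k%:Z + 1)%:~R - c by rewrite !rmorphD /=; lra.
exact: int_sub_frac_neq0.
Qed.

Lemma nat_add_pr_neq0 (n : nat) : n%:R + p%:R * r != 0.
Proof. exact: (int_add_pr_neq0 n). Qed.
Lemma nat_sub_pr_neq0 (n : nat) : n%:R - p%:R * r != 0.
Proof. by have := int_add_pr_neq0 (- n%:Z); rewrite -oppr_eq0 opprD rmorphN /= opprK. Qed.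
Lemma nat_sub_pc_neq0 (n : nat) : n%:R - p%:R * c != 0.
Proof. by have := int_add_pc_neq0 (- n%:Z); rewrite -oppr_eq0 opprD rmorphN /= opprK. Qed.
Lemma sub_add_pr_neq0 (n j : nat) : n%:R - j%:R + p%:R * r != 0.
Proof. by have := int_add_pr_neq0 (n%:Z - j%:Z); rewrite rmorphB. Qed.
Lemma sub_add_pc_neq0 (n j : nat) : n%:R - j%:R + p%:R * c != 0.
Proof. by have := int_add_pc_neq0 (n%:Z - j%:Z); rewrite rmorphB. Qed.

Lemma denA_neq0 (n : nat) : denA n%:R != 0.
Proof. by apply/prodf_neq0 => j _; apply: sub_add_pr_neq0. Qed.
Lemma denB_neq0 (n : nat) : denB n%:R != 0.
Proof. by apply/prodf_neq0 => j _; apply: sub_add_pc_neq0. Qed.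

Let step_cancel (F : fieldType) (N A B N' A' B' x1 x2 y1 y2 u1 v1 u2 v2 : F) :
  N' * (x1 * x2) = N * (y1 * y2) -> A' * u1 = v1 * A -> B' * u2 = v2 * B ->
  A != 0 -> B != 0 -> A' != 0 -> B' != 0 ->
  N' / (A' * B') * (x1 * x2 * v1 * v2) = N / (A * B) * (y1 * y2 * u1 * u2).
Proof.
move=> e1 e2 e3 A0 B0 A'0 B'0.
apply: (mulIf A0); apply: (mulIf B0); apply: (mulIf A'0); apply: (mulIf B'0).
have -> : N' / (A' * B') * (x1 * x2 * v1 * v2) * A * B * A' * B' =
  (N' * (x1 * x2)) * (v1 * A) * (v2 * B) by field; rewrite A'0 B'0.
rewrite e1 -e2 -e3; field; by rewrite A0 B0.
Qed.

(** Passing to [n + 1] moves each of the four runs of consecutive factors by one, so only their end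
    factors remain. *)
Lemma ratfun_step (n : nat) :
  ratfun n.+1%:R * ((n.+1%:R - p%:R * r) * (n%:R + k.+2%:R - p%:R * c) *
                   (n.+1%:R + p%:R * r) * (n%:R - k%:R + p%:R * c)) =
  ratfun n%:R * ((n%:R + J.+1%:R - p%:R * r) * (n%:R + m.+1%:R - p%:R * c) *
                (n%:R - J%:R + p%:R * r) * (n%:R - m%:R + p%:R * c)).
Proof.
apply: step_cancel; try exact: denA_neq0; try exact: denB_neq0.
- rewrite /numer.
  have h1 := rising_shift (n%:R + 1 - p%:R * r) J.
  have h2 := rising_shift (n%:R + k.+2%:R - p%:R * c) (m - k.+1).
  rewrite -[n.+1%:R]natr1.
  have -> : n%:R + 1 + 1 - p%:R * r = n%:R + 1 - p%:R * r + 1 by ring.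
  have -> : n%:R + 1 + k.+2%:R - p%:R * c = n%:R + k.+2%:R - p%:R * c + 1 by ring.
  have -> : n%:R + m.+1%:R - p%:R * c = n%:R + k.+2%:R - p%:R * c + (m - k.+1)%:R.
    have -> : m.+1%:R = k.+2%:R + (m - k.+1)%:R :> rat.
      by rewrite -natrD; congr _%:R; nat_lia.
    ring.
  rewrite -[J.+1%:R]natr1.
  have -> : n%:R + (J%:R + 1) - p%:R * r = n%:R + 1 - p%:R * r + J%:R by ring.
  by rewrite mulrACA h1 h2 mulrACA.
- rewrite /denA; pose f t j : rat := t - j%:R + p%:R * r.
  rewrite (big_ord_range _ 0 (f n.+1%:R)) ?(big_ord_range _ 0 (f n%:R)); try nat_lia.
  have -> : n%:R - J%:R + p%:R * r = n%:R + p%:R * r + 1 - J.+1%:R by rewrite -natr1; ring.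
  have -> : n.+1%:R + p%:R * r = n%:R + p%:R * r + 1 - 0%:R by rewrite -natr1; ring.
  by apply: prod_nat_shift => // j; rewrite /f -?natr1; ring.
- rewrite /denB; pose f t j : rat := t - j%:R + p%:R * c.
  rewrite (big_ord_range _ k.+1 (f n.+1%:R)) ?(big_ord_range _ k.+1 (f n%:R)); try nat_lia.
  have km : (k.+1 <= m.+1)%N by nat_lia.
  have -> : n%:R - m%:R + p%:R * c = n%:R + p%:R * c + 1 - m.+1%:R by rewrite -natr1; ring.
  have -> : n%:R - k%:R + p%:R * c = n%:R + p%:R * c + 1 - k.+1%:R by rewrite -natr1; ring.
  by apply: prod_nat_shift => // j; rewrite /f -?natr1; ring.
Qed.

(** The reason for the choice of [J]: [p r - J] and [J + 1 - p r] are [r] and [1 - r] in some order,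
    so [term] and [ratfun] share these factors in their steps. *)
Let prm_mul (n : nat) :
  (r + n%:R) * (1 - r + n%:R) = (n%:R - J%:R + p%:R * r) * (n%:R + J.+1%:R - p%:R * r).
Proof.
rewrite -natr1; case: rJ => h.
  have -> : p%:R * r = r + J%:R by lra.
  ring.
have -> : p%:R * r = 1 - r + J%:R by lra.
ring.
Qed.

(** Likewise [p c - k] and [k + 2 - p c] are [1 + c] and [1 - c] in some order. *)
Let pcm_mul (n : nat) :
  (1 + c + n%:R) * (1 - c + n%:R) = (n%:R - k%:R + p%:R * c) * (n%:R + k.+2%:R - p%:R * c).
Proof.
rewrite -natr1 -natr1; case: ck => h.
  have -> : p%:R * c = 1 + c + k%:R by lra.
  ring.
have -> : p%:R * c = 1 - c + k%:R by lra.
ring.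
Qed.

Let onep_neq0 (n : nat) : 1 + n%:R != 0 :> rat.
Proof. by rewrite nat1r pnatr_eq0. Qed.

Let onepc_neq0 (n : nat) : 1 + c + n%:R != 0.
Proof.
have -> : 1 + c + n%:R = n.+1%:R + c by rewrite -natr1; ring.
exact: (int_add_frac_neq0 n.+1 c01).
Qed.

Let onemc_neq0 (n : nat) : 1 - c + n%:R != 0.
Proof.
have -> : 1 - c + n%:R = n.+1%:R - c by rewrite -natr1; ring.
exact: (int_sub_frac_neq0 n.+1 c01).
Qed.

Lemma term0 : term 0 = 1.
Proof. by rewrite /term /rising !big_ord0; field. Qed.

Lemma rising_neq0 a n : (forall i : nat, a + i%:R != 0) -> rising a n != 0.
Proof. by move=> h; apply/prodf_neq0. Qed.

Lemma termS n : term n.+1 =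
  term n * ((n%:R + 1 / 2) ^+ 2 * ((r + n%:R) * (1 - r + n%:R))) /
  (n.+1%:R ^+ 2 * ((1 + c + n%:R) * (1 - c + n%:R))).
Proof.
rewrite /term !risingS -[n.+1%:R]nat1r.
have h1 := rising_neq0 n onep_neq0; have h2 := rising_neq0 n onepc_neq0.
have h3 := rising_neq0 n onemc_neq0.
have h4 := onep_neq0 n; have h5 := onepc_neq0 n; have h6 := onemc_neq0 n.
by field; rewrite ?h1 ?h2 ?h3 ?h4 ?h5 ?h6.
Qed.

(** Since [p = 2m + 1], the numbers [n + m + 1 - p c] and [n - m + p c] have midpoint [n + 1/2] and
    half-difference [p (1/2 - c)]. *)
Let error_factorE (n : nat) : error_factor n =
  (n%:R + 1 / 2) ^+ 2 * ((n.+1%:R - p%:R * r) * (n.+1%:R + p%:R * r)) /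
  ((n%:R + m.+1%:R - p%:R * c) * (n%:R - m%:R + p%:R * c) * n.+1%:R ^+ 2).
Proof.
rewrite /error_factor; congr (_ * _ / (_ * _)); first by ring.
by rewrite pE -natr1; field.
Qed.

(** The induction step for [term_ratfun] over an abstract field: the factors [e], [g], [a], [d]
    common to both recurrences cancel. *)
Let telescope (F : fieldType) (T T' R R' R0 E N h a d e g x y z w : F) :
  T' = T * (h ^+ 2 * (e * g)) / (N ^+ 2 * (a * d)) ->
  R' * (x * d * y * a) = R * (g * z * e * w) ->
  T * R0 = R * E ->
  a != 0 -> d != 0 -> x != 0 -> y != 0 -> z != 0 -> w != 0 -> N != 0 ->
  T' * R0 = R' * (E * (h ^+ 2 * (x * y) / (z * w * N ^+ 2))).
Proof.
move=> -> e2 e3 a0 d0 x0 y0 z0 w0 N0.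
have -> : R' = R * (g * z * e * w) / (x * d * y * a).
  by rewrite -e2 mulfK // !mulf_neq0.
transitivity ((T * R0) * (h ^+ 2 * (e * g)) / (N ^+ 2 * (a * d))).
  by field; rewrite ?a0 ?d0 ?N0.
by rewrite e3; field; rewrite ?a0 ?d0 ?x0 ?y0 ?z0 ?w0 ?N0.
Qed.

Lemma term_ratfun (n : nat) :
  term n * ratfun 0%:R = ratfun n%:R * \prod_(i < n) error_factor i.
Proof.
elim: n => [|n IH]; first by rewrite term0 big_ord0 mulr1 mul1r.
rewrite big_ord_recr /= error_factorE.
have := termS n; rewrite prm_mul pcm_mul => tS.
apply: (telescope tS (ratfun_step n) IH).
- exact: sub_add_pc_neq0.
- by rewrite -natrD nat_sub_pc_neq0.
- exact: nat_sub_pr_neq0.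
- exact: nat_add_pr_neq0.
- by rewrite -natrD nat_sub_pc_neq0.
- exact: sub_add_pc_neq0.
- by rewrite pnatr_eq0.
Qed.

Let half_neq0 (n : nat) : n%:R + 1 / 2 != 0 :> rat.
Proof. by apply: (int_add_frac_neq0 n). Qed.

Let c_neq0 (n : nat) : n%:R + c != 0.
Proof. exact: (int_add_frac_neq0 n c01). Qed.
Let mc_neq0 (n : nat) : n%:R + 1 - c != 0.
Proof. rewrite natr1; exact: (int_sub_frac_neq0 n.+1 c01). Qed.

Let error_generic (n : nat) : ~~ (p %| n.+1)%N -> ~~ (p %| n.*2.+1)%N ->
  error_factor n = unit_factor n.
Proof.
move=> /negPf h1 /negPf h2; rewrite /unit_factor h1 h2 /error_factor.
have n0 : n.+1%:R != 0 :> rat by rewrite pnatr_eq0.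
have n1 := half_neq0 n; set x := n%:R + 1 / 2 in n1 *; set y := n.+1%:R in n0 *.
set u := p%:R ^+ 2 * (1 / 2 - c) ^+ 2; set v := p%:R ^+ 2 * r ^+ 2.
have d0 : x ^+ 2 - u != 0.
  have -> : x ^+ 2 - u = (n%:R + m.+1%:R - p%:R * c) * (n%:R - m%:R + p%:R * c).
    by rewrite /x /u pE -natr1; field.
  by rewrite mulf_neq0 ?sub_add_pc_neq0 // -natrD nat_sub_pc_neq0.
by field; rewrite ?n0 ?n1 ?d0 ?onep_neq0.
Qed.

(** Here [n + 1/2 = p (b + 1/2)], so [p^2] cancels against the denominator and a function of [b]
    alone splits off. *)
Let error_half (b : nat) : error_factor (m + b * p) =
  unit_factor (m + b * p) * ((b%:R + 1 / 2) ^+ 2 / ((b%:R + c) * (b%:R + 1 - c))).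
Proof.
have h1 : (p %| (m + b * p).+1)%N = false.
  rewrite -addSn dvdn_addl ?dvdn_mull // gtnNdvd //; nat_lia.
have h2 : (p %| (m + b * p).*2.+1)%N.
  have -> : ((m + b * p).*2.+1 = p + b * p * 2)%N by nat_lia.
  by rewrite dvdn_addr // dvdn_mulr // dvdn_mull.
rewrite /unit_factor h1 h2 /error_factor divr1.
have -> : (m + b * p)%:R + 1 / 2 = p%:R * (b%:R + 1 / 2) :> rat.
  by rewrite natrD natrM pE; field.
have n0 : 1 + (m%:R + b%:R * p%:R) != 0 :> rat by rewrite -natrM -natrD onep_neq0.
have b0 := c_neq0 b; have b1 := mc_neq0 b.
have -> : (p%:R * (b%:R + 1 / 2)) ^+ 2 - p%:R ^+ 2 * (1 / 2 - c) ^+ 2 =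
  p%:R ^+ 2 * ((b%:R + c) * (b%:R + 1 - c)) by field.
by field; rewrite ?n0 ?onep_neq0 ?b0 ?b1 ?p_neq0.
Qed.

(** Here [n + 1 = p (b + 1)], and [p^2] cancels in the factor involving [r]. *)
Let error_last (b : nat) : error_factor (p.-1 + b * p) =
  unit_factor (p.-1 + b * p) * ((b.+1%:R ^+ 2 - r ^+ 2) / b.+1%:R ^+ 2).
Proof.
have h1 : ((p.-1 + b * p).+1 = b.+1 * p)%N by nat_lia.
have h2 : (p %| (p.-1 + b * p).*2.+1)%N = false.
  have -> : ((p.-1 + b * p).*2.+1 = p.-1 + (p * b.*2.+1))%N by nat_lia.
  rewrite dvdn_addl ?dvdn_mulr // gtnNdvd //; nat_lia.
rewrite /unit_factor h2 h1 dvdn_mull // /error_factor h1 natrM.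
have n1 := half_neq0 (p.-1 + b * p); set x := _%:R + 1 / 2 in n1 *.
set u := p%:R ^+ 2 * (1 / 2 - c) ^+ 2.
have d0 : x ^+ 2 - u != 0.
  have -> : x ^+ 2 - u = ((p.-1 + b * p)%:R + m.+1%:R - p%:R * c) *
                         ((p.-1 + b * p)%:R - m%:R + p%:R * c).
    by rewrite /x /u pE -natr1; field.
  by rewrite mulf_neq0 ?sub_add_pc_neq0 // -natrD nat_sub_pc_neq0.
have b0 : b.+1%:R != 0 :> rat by rewrite pnatr_eq0.
by field; rewrite ?n1 ?d0 ?b0 ?onep_neq0 ?p_neq0.
Qed.

(** Over a full block the two exceptional factors multiply to the ratio of the values of
    [term b * (b + r) * (b + c)] at [b + 1] and at [b]. The other factors are collected in
    [unit_part]. *)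
Lemma prod_error (a b : nat) : (a < p)%N ->
  \prod_(i < a + b * p) error_factor i =
  term b * (b%:R + r) * (b%:R + c) / (r * c) * excess a b * unit_part (a + b * p).
Proof.
have r0 : r != 0 by case/andP: r01 => /gt_eqF ->.
have c0 : c != 0 by case/andP: c01 => /gt_eqF ->.
have step a' b' : (a'.+1 < p)%N ->
    \prod_(i < a' + b' * p) error_factor i =
      term b' * (b'%:R + r) * (b'%:R + c) / (r * c) * excess a' b' * unit_part (a' + b' * p) ->
    \prod_(i < a'.+1 + b' * p) error_factor i =
      term b' * (b'%:R + r) * (b'%:R + c) / (r * c) * excess a'.+1 b' *
      unit_part (a'.+1 + b' * p).
  move=> ap IH; rewrite /unit_part addSn !big_ord_recr /= IH -/(unit_part _).
  have [am|am] := eqVneq a' m.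
    by rewrite am error_half /excess leqnn ltnn; ring.
  rewrite error_generic.
  - have -> : excess a'.+1 b' = excess a' b' by rewrite /excess ltn_neqAle am.
    ring.
  - by rewrite -addSn dvdn_addl ?dvdn_mull // gtnNdvd.
  (* The odd number [2a' + 1] is a multiple of [p] below [2p], hence equal to [p], so [a' = m]. *)
  - apply: contra am => /dvdnP [q' e]; apply/eqP.
    have : (q' * p = a'.*2.+1 + b'.*2 * p)%N by rewrite -e doubleD -doubleMl.
    move=> e2; have : ((q' - b'.*2) * p = a'.*2.+1)%N by rewrite mulnBl e2 addnK.
    case: (q' - b'.*2)%N => [|[|x]]; nat_nia.
elim: b a => [|b IHb]; elim=> [|a IHa] ap.
- by rewrite /unit_part !big_ord0 term0 /excess /=; field; rewrite ?r0 ?c0.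
- by apply: step => //; apply: IHa; apply: ltnW.
(* End of a block: the factor at [p - 1] joins the one at [m], held in [excess], to complete the
   step of [term] from [b] to [b + 1]. *)
- have -> : (0 + b.+1 * p = (p.-1 + b * p).+1)%N by nat_lia.
  rewrite /unit_part !big_ord_recr /= -/(unit_part _) IHb; last by nat_lia.
  rewrite error_last /excess leqNgt (_ : (m < p.-1)%N) /=; last by nat_lia.
  have b0 := c_neq0 b; have b1 := mc_neq0 b; have b2 := c_neq0 b.+1; have b3 := mc_neq0 b.+1.
  have b4 : b%:R + 1 != 0 :> rat by rewrite natr1 pnatr_eq0.
  have b5 := onemc_neq0 b.
  have b6 := onepc_neq0 b.
  rewrite termS -!natr1 in b2 b3 *.
  by field; rewrite ?r0 ?c0 ?b0 ?b1 ?b4 ?b5 ?b6.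
- by apply: step => //; apply: IHa; apply: ltnW.
Qed.

(** * Correction factors modulo [p^3] *)

Hypothesis p_prime : prime p.
Hypothesis p_gt3 : (3 < p)%N.
Hypothesis pint_r : pint p r.
Hypothesis pint_c : pint p c.
Hypothesis red_r : red p r != 0.
Hypothesis red_c : red p c != 0.
Hypothesis red_rc : red p (c - r) != 0.
Hypothesis red_1c : red p (1 - c) != 0.

Local Notation pint := (pint p).
Local Notation red := (red p).

Let two_neq0 : 2%:R != 0 :> 'F_p.
Proof. by rewrite natF_eq0 // gtnNdvd // (ltn_trans _ p_gt3). Qed.

Let pint_half : pint (1 / 2).
Proof. by rewrite mul1r pintV ?(pint_nat p 2) // (red_nat p 2). Qed.

Let red_half : red (1 / 2) = 2%:R^-1.
Proof. by rewrite mul1r redV ?(pint_nat p 2) // (red_nat p 2). Qed.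

Let pint_p2 : pint (p%:R ^+ 2).
Proof. by rewrite pintX ?pint_nat. Qed.

Let red_p2 x : pint x -> red (p%:R ^+ 2 * x) = 0.
Proof.
move=> px; rewrite expr2 -mulrA (redM p_prime (pint_nat p p)) ?pintM ?pint_nat //.
by rewrite red_p // mul0r.
Qed.

Let mul_sq_div (F : fieldType) (a x y : F) : a * x ^+ 2 / y ^+ 2 = a * (x / y) ^+ 2.
Proof. by rewrite expr_div_n -mulrA. Qed.

(** The coefficient of [p^2] in [unit_factor], modulo [p]. The convention [0^-1 = 0] lets one
    formula cover the exceptional indices. *)
Definition unit_slope (x : 'F_p) : 'F_p :=
  red (1 / 2 - c) ^+ 2 * (x + 2%:R^-1)^-1 ^+ 2 - red r ^+ 2 * (x + 1)^-1 ^+ 2.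

Lemma unit_factor_congr i : exists s,
  [/\ pint s, unit_factor i = 1 + p%:R ^+ 2 * s & red s = unit_slope i%:R].
Proof.
pose u : rat := if (p %| i.+1)%N then 0 else (r * i.+1%:R^-1) ^+ 2.
pose v : rat := if (p %| i.*2.+1)%N then 0 else ((1 / 2 - c) * (i%:R + 1 / 2)^-1) ^+ 2.
have [pu ru] : pint u /\ red u = red r ^+ 2 * (i%:R + 1)^-1 ^+ 2.
  rewrite /u natr1 -(natF_eq0 p_prime); case: eqP => [->|/eqP i0].
    by rewrite pint0 red0 invr0 expr0n mulr0.
  have pi : pint i.+1%:R^-1 by rewrite pintV ?pint_nat ?red_nat.
  have pm := pintM p_prime pint_r pi.
  by rewrite pintX // (redX p_prime 2 pm) (redM p_prime pint_r pi)
    redV ?pint_nat ?red_nat // exprMn.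
have [pv rv] : pint v /\ red v = red (1 / 2 - c) ^+ 2 * (i%:R + 2%:R^-1)^-1 ^+ 2.
  have -> : i%:R + 2%:R^-1 = i.*2.+1%:R / 2%:R :> 'F_p.
    by rewrite -[i.*2.+1%:R]natr1 -muln2 natrM mulrDl mulfK // mul1r.
  rewrite /v -(natF_eq0 p_prime); case: eqP => [->|/eqP i0].
    by rewrite pint0 red0 mul0r invr0 expr0n mulr0.
  have ri : red (i%:R + 1 / 2) = i.*2.+1%:R / 2%:R.
    rewrite redD ?pint_nat // red_half red_nat -[i.*2.+1%:R]natr1 -muln2 natrM mulrDl.
    by rewrite mulfK // mul1r.
  have ri0 : red (i%:R + 1 / 2) != 0 by rewrite ri mulf_neq0 // invr_eq0.
  have pi : pint (i%:R + 1 / 2) by rewrite pintD ?pint_nat.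
  have pi' := pintV p_prime pi ri0.
  have ph : pint (1 / 2 - c) by rewrite pintB.
  have pm := pintM p_prime ph pi'.
  by rewrite pintX // (redX p_prime 2 pm) (redM p_prime ph pi') (redV p_prime pi ri0) ri exprMn.
have pp := pint_p2.
have ppv := pintM p_prime pp pv.
have rd : red (1 - p%:R ^+ 2 * v) = 1.
  by rewrite (redB p_prime (pint1 p) ppv) (red_p2 pv) red1 subr0.
have pd := pintB p_prime (pint1 p) ppv.
have d1 : 1 - p%:R ^+ 2 * v != 0 by apply: (@red_neq0 p); rewrite rd oner_eq0.
have pdV : pint (1 - p%:R ^+ 2 * v)^-1 by rewrite pintV // rd oner_eq0.
(* From [(1 - p^2 u)/(1 - p^2 v) = 1 + p^2 (v - u)/(1 - p^2 v)], whose last denominator reduces to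
   [1]. *)
exists ((v - u) / (1 - p%:R ^+ 2 * v)); split.
- by rewrite pintM ?pintB.
- have -> : unit_factor i = (1 - p%:R ^+ 2 * u) / (1 - p%:R ^+ 2 * v).
    rewrite /unit_factor /u /v; congr (_ / _); case: ifP => _; rewrite ?mulr0 ?subr0 //.
      by congr (1 - _); apply: mul_sq_div.
    by congr (1 - _); apply: mul_sq_div.
  by field.
- rewrite (redM p_prime (pintB p_prime pv pu) pdV) (redV p_prime pd) ?rd ?oner_eq0 //.
  by rewrite invr1 mulr1 (redB p_prime pv pu) ru rv.
Qed.

Lemma unit_part_congr n : exists S,
  [/\ pint S, unit_part n = 1 + p%:R ^+ 2 * S & red S = \sum_(i < n) unit_slope i%:R].
Proof.
elim: n => [|n [S [pS eS rS]]].
  by exists 0; rewrite pint0 /unit_part !big_ord0 mulr0 addr0 red0.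
have [s [ps es rs]] := unit_factor_congr n.
have pp := pint_p2.
have pSs : pint (S * s) by rewrite pintM.
have pSs' : pint (p%:R ^+ 2 * (S * s)) by rewrite pintM.
exists (S + s + p%:R ^+ 2 * (S * s)); split.
- by rewrite !pintD.
- by rewrite /unit_part big_ord_recr /= -/(unit_part n) eS es; ring.
- rewrite big_ord_recr /= -rS -rs (redD p_prime (pintD p_prime pS ps) pSs') (redD p_prime pS ps).
  by rewrite (red_p2 pSs) addr0.
Qed.

(** A full block contributes two complete sums of inverse squares, both zero. *)
Lemma sum_unit_slope_period a b :
  \sum_(i < a + b * p) unit_slope i%:R = \sum_(i < a) unit_slope i%:R.
Proof.
have full : \sum_(i < p) unit_slope i%:R = 0.
  rewrite /unit_slope sumrB -!mulr_sumr.
  rewrite (sum_ord_Fp p_prime (fun x => x^-1 ^+ 2)).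
  by rewrite (sum_ord_Fp p_prime (fun x => x^-1 ^+ 2)) sum_inv_sqr // !mulr0 subr0.
elim: b => [|b IH]; first by rewrite mul0n addn0.
rewrite mulSn addnCA big_split_ord /= full add0r -[RHS]IH; apply: eq_bigr => i _.
by rewrite natrD pF0 // add0r.
Qed.

(** * Values of the rational function at [a + p b] modulo [p] *)

Definition cofactor_den (a : nat) (t : rat) : rat :=
  \prod_(j < p | (j < J.+1)%N && (j != a :> nat)) (t - j%:R + p%:R * r) *
  \prod_(j < p | (k < j < m.+1)%N && (j != a :> nat)) (t - j%:R + p%:R * c).
(** [ratfun] without its denominator factors of index [a]. At [t = a + p y] these are [p (y + r)]
    and [p (y + c)], while the other denominator factors are units. *)
Definition cofactor (a : nat) (t : rat) : rat := numer t / cofactor_den a t.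

Let pint_py y : pint y -> pint (p%:R * y).
Proof. by move=> py; rewrite pintM ?pint_nat. Qed.
Let red_py y : pint y -> red (p%:R * y) = 0.
Proof. by move=> py; rewrite redM ?pint_nat // red_p // mul0r. Qed.

Let rising_red z n : pint z ->
  pint (rising z n) /\ red (rising z n) = \prod_(i < n) (red z + i%:R).
Proof.
move=> pz; have pzi (i : nat) : pint (z + i%:R) by rewrite pintD ?pint_nat.
rewrite /rising (pint_prod p_prime) ?(red_prod p_prime) //.
by split=> //; apply: eq_bigr => i _; rewrite redD ?pint_nat // red_nat.
Qed.

Definition red_cofactor_den (a : nat) : 'F_p :=
  \prod_(j < p | (j < J.+1)%N && (j != a :> nat)) (a%:R - j%:R) *
  \prod_(j < p | (k < j < m.+1)%N && (j != a :> nat)) (a%:R - j%:R).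
Definition red_cofactor (a : nat) : 'F_p :=
  (\prod_(i < J) (a.+1%:R + i%:R) * \prod_(i < m - k.+1) ((a + k.+2)%:R + i%:R)) /
  red_cofactor_den a.

Lemma red_cofactor_den_neq0 a : (a < p)%N -> red_cofactor_den a != 0.
Proof.
move=> ap.
have nz (P : pred 'I_p) : \prod_(j < p | P j && (j != a :> nat)) (a%:R - j%:R) != 0 :> 'F_p.
  by apply/prodf_neq0 => j /andP[_ ja]; rewrite subr_eq0 natF_eq // eq_sym.
by rewrite mulf_neq0.
Qed.

Let pint_shifted a y : pint y -> pint (a%:R + p%:R * y).
Proof. by move=> py; rewrite pintD ?pint_nat ?pint_py. Qed.
Let red_shifted a y : pint y -> red (a%:R + p%:R * y) = a%:R.
Proof. by move=> py; rewrite redD ?pint_nat ?pint_py // red_nat red_py // addr0. Qed.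

Lemma cofactor_den_red a y : (a < p)%N -> pint y ->
  pint (cofactor_den a (a%:R + p%:R * y)) /\
  red (cofactor_den a (a%:R + p%:R * y)) = red_cofactor_den a.
Proof.
move=> ap py; have pt := pint_shifted a py; have rt := red_shifted a py.
set t := a%:R + _ in pt rt *.
have den (P : pred 'I_p) x : pint x ->
    pint (\prod_(j < p | P j && (j != a :> nat)) (t - j%:R + p%:R * x)) /\
    red (\prod_(j < p | P j && (j != a :> nat)) (t - j%:R + p%:R * x)) =
    \prod_(j < p | P j && (j != a :> nat)) (a%:R - j%:R).
  move=> px; have pj (j : nat) : pint (t - j%:R + p%:R * x).
    by rewrite pintD ?pintB ?pint_py ?pint_nat.
  rewrite (pint_prod p_prime) ?(red_prod p_prime) //; split=> //; apply: eq_bigr => j _.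
  by rewrite redD ?pintB ?pint_nat ?pint_py // redB ?pint_nat // rt red_nat red_py // addr0.
have [pd1 rd1] := den (fun j : 'I_p => (j < J.+1)%N) r pint_r.
have [pd2 rd2] := den (fun j : 'I_p => (k < j < m.+1)%N) c pint_c.
by rewrite /cofactor_den (pintM p_prime pd1 pd2) (redM p_prime pd1 pd2) rd1 rd2.
Qed.

Lemma cofactor_red a y : (a < p)%N -> pint y ->
  pint (cofactor a (a%:R + p%:R * y)) /\
  red (cofactor a (a%:R + p%:R * y)) = red_cofactor a.
Proof.
move=> ap py; have pt := pint_shifted a py; have rt := red_shifted a py.
have [pd rd] := cofactor_den_red ap py; have d0 := red_cofactor_den_neq0 ap.
rewrite -rd in d0; rewrite /red_cofactor -rd.
set t := a%:R + _ in pt rt pd d0 *.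
have pr := pint_py pint_r; have pc := pint_py pint_c.
have pt1 := pintD p_prime pt (pint1 p).
have pt2 := pintD p_prime pt (pint_nat p k.+2).
have pz1 := pintB p_prime pt1 pr.
have rz1 : red (t + 1 - p%:R * r) = a.+1%:R.
  rewrite (redB p_prime pt1 pr) (redD p_prime pt (pint1 p)) rt red1 red_py //.
  by rewrite subr0 natr1.
have pz2 := pintB p_prime pt2 pc.
have rz2 : red (t + k.+2%:R - p%:R * c) = (a + k.+2)%:R.
  rewrite (redB p_prime pt2 pc) (redD p_prime pt (pint_nat p _)) rt red_nat red_py //.
  by rewrite subr0 natrD.
have [pn1 rn1] := rising_red J pz1; have [pn2 rn2] := rising_red (m - k.+1) pz2.
have pn := pintM p_prime pn1 pn2; have pdV := pintV p_prime pd d0.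
rewrite /cofactor /numer (pintM p_prime pn pdV) (redM p_prime pn pdV).
by rewrite (redM p_prime pn1 pn2) (redV p_prime pd d0) rn1 rn2 rz1 rz2.
Qed.

Lemma pint_cofactor a y : (a < p)%N -> pint y -> pint (cofactor a (a%:R + p%:R * y)).
Proof. by move=> ap py; case: (cofactor_red ap py). Qed.
Lemma red_cofactorE a y : (a < p)%N -> pint y ->
  red (cofactor a (a%:R + p%:R * y)) = red_cofactor a.
Proof. by move=> ap py; case: (cofactor_red ap py). Qed.

(** The numerator reduces to the product of [a+1, ..., a+J] and [a+k+2, ..., a+m]. As [k < J] there
    is no gap between these ranges, and [a < p <= a + m], so [p] occurs. *)
Lemma red_cofactor_eq0 a : (m < a < p)%N -> red_cofactor a = 0.
Proof.
case/andP=> ma ap; rewrite /red_cofactor.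
have vanish n x i : (i < n)%N -> (x + i = p)%N ->
    \prod_(i0 < n) (x%:R + i0%:R) = 0 :> 'F_p.
  move=> ni e; apply/eqP/prodf_eq0; exists (Ordinal ni) => //=.
  by rewrite -natrD e pF0.
have [h|h] := leqP (p - J) a.
  have i1 : (p.-1 - a < J)%N by nat_lia.
  have i2 : (a.+1 + (p.-1 - a) = p)%N by nat_lia.
  by rewrite (vanish _ _ _ i1 i2) !mul0r.
have i1 : (p - k.+2 - a < m - k.+1)%N by nat_lia.
have i2 : (a + k.+2 + (p - k.+2 - a) = p)%N by nat_lia.
by rewrite (vanish _ _ _ i1 i2) mulr0 mul0r.
Qed.

(** The prefactors clear the denominator factors of index [a], the only ones that are not units at
    [p]. *)
Definition scaled_ratfun (a b : nat) : rat :=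
  p%:R * (b%:R + r) * (p%:R * (b%:R + c)) * ratfun (a + b * p)%:R.

Lemma prod_D1_if (P : pred 'I_p) (f : nat -> rat) a (ap : (a < p)%N) :
  \prod_(j < p | P j) f j = (if P (Ordinal ap) then f a else 1) *
     \prod_(j < p | P j && (j != a :> nat)) f j.
Proof.
case: ifP => Pa; first by rewrite (bigD1 (Ordinal ap)) //=.
rewrite mul1r; apply: eq_bigl => j.
by rewrite andb_idr // => Pj; apply: contraFneq Pa => e; rewrite (_ : Ordinal ap = j) //; apply: val_inj.
Qed.

Lemma scaled_ratfunE a b : (a < p)%N ->
  scaled_ratfun a b = cofactor a (a%:R + p%:R * b%:R) *
    (if (a < J.+1)%N then 1 else p%:R * (b%:R + r)) *
    (if (k < a < m.+1)%N then 1 else p%:R * (b%:R + c)).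
Proof.
move=> ap; rewrite /scaled_ratfun /ratfun /denA /denB /cofactor /cofactor_den natrD natrM [b%:R * _]mulrC.
set t := a%:R + _.
rewrite (@prod_D1_if (fun j => (j < J.+1)%N) (fun j => t - j%:R + p%:R * r) a ap) /=.
rewrite (@prod_D1_if (fun j => (k < j < m.+1)%N) (fun j => t - j%:R + p%:R * c) a ap) /=.
set DA := \prod_(_ < p | _ && _) _; set DB := \prod_(_ < p | _ && _) _.
have tE : t = (a + b * p)%:R by rewrite natrD natrM [b%:R * _]mulrC.
have DA0 : DA != 0 by apply/prodf_neq0 => j _; rewrite tE sub_add_pr_neq0.
have DB0 : DB != 0 by apply/prodf_neq0 => j _; rewrite tE sub_add_pc_neq0.
have -> : t - a%:R + p%:R * r = p%:R * (b%:R + r) by rewrite /t; ring.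
have -> : t - a%:R + p%:R * c = p%:R * (b%:R + c) by rewrite /t; ring.
have br : b%:R + r != 0 by exact: (int_add_frac_neq0 b r01).
have bc := c_neq0 b.
by case: ifP => _; case: ifP => _; field; rewrite ?DA0 ?DB0 ?br ?bc ?p_neq0.
Qed.

(** * Partial fractions of [ratfun] and sums over a block *)

Definition coefA (j : nat) : rat := cofactor j (j%:R + p%:R * (- r)) /
  (if (k < j < m.+1)%N then p%:R * (c - r) else 1).
(** Like [coefA], a residue of [ratfun]: here at [j - p c], there at [j - p r]. [cofactor] drops
    both factors of index [j], so the one from the other range is put back. *)
Definition coefB (j : nat) : rat := cofactor j (j%:R + p%:R * (- c)) /
  (if (j < J.+1)%N then p%:R * (r - c) else 1).

Let pole (s : 'I_p + 'I_p) : rat :=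
  match s with inl j => j%:R + p%:R * (- r) | inr j => j%:R + p%:R * (- c) end.
Let is_pole (s : 'I_p + 'I_p) : bool :=
  match s with inl j => (j < J.+1)%N | inr j => (k < j < m.+1)%N end.
Let numer_poly : {poly rat} :=
  \prod_(i < J) ('X - (- (1 - p%:R * r + i%:R))%:P) *
  \prod_(i < m - k.+1) ('X - (- (k.+2%:R - p%:R * c + i%:R))%:P).

Let horner_numer_poly t : numer_poly.[t] = numer t.
Proof.
rewrite /numer_poly /numer /rising hornerM !horner_prod.
by congr (_ * _); apply: eq_bigr => i _; rewrite hornerXsubC; ring.
Qed.

Let card_range lo hi : (hi <= p)%N -> #|[pred j : 'I_p | (lo <= j < hi)%N]| = (hi - lo)%N.
Proof.
move=> hp; rewrite -sum1_card (big_ord_range _ lo (fun=> 1%N) hp).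
by rewrite sum_nat_const_nat muln1.
Qed.

Let card_poles : #|is_pole| = (J.+1 + (m - k))%N.
Proof.
rewrite -sum1_card big_sumType /= !sum1_card.
have := @card_range 0 J.+1; have := @card_range k.+1 m.+1 => -> => [-> |]; nat_lia.
Qed.

(** The degree is [J + (m - k - 1)] against [J + 1 + (m - k)] poles, two more; hence the residues
    sum to zero. *)
Let size_numer_poly : (size numer_poly < #|is_pole|)%N.
Proof.
rewrite card_poles size_Mmonic ?monic_prod_XsubC ?monic_neq0 //; last exact: monic_prod_XsubC.
have size_index n : size (index_enum 'I_n) = n by rewrite -sum1_size sum_nat_const card_ord muln1.
by rewrite !size_prod_XsubC !size_index; nat_lia.
Qed.

(** Poles of the two families differ by [p (c - r)] when their indices agree, and are distinct
    modulo [p] otherwise. *)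
Let pole_inj : {in is_pole &, injective pole}.
Proof.
have same (x : rat) (i j : 'I_p) : i%:R + p%:R * x = j%:R + p%:R * x -> i = j.
  by move/addIr/eqP; rewrite eqr_nat => /eqP; exact: val_inj.
have cross (i j : 'I_p) : i%:R + p%:R * (- r) != j%:R + p%:R * (- c).
  rewrite -subr_eq0.
  have -> : i%:R + p%:R * - r - (j%:R + p%:R * - c) = i%:R - j%:R + p%:R * (c - r) by ring.
  have [->|ij] := eqVneq i j.
    by rewrite subrr add0r mulf_neq0 ?(red_neq0 red_rc).
  apply: (@red_neq0 p); apply: red_shift_neq0 => //.
  by rewrite pintB.
move=> [i|i] [j|j] _ _ /= e.
- by rewrite (same _ _ _ e).
- by have := cross i j; rewrite e eqxx.
- by have := cross j i; rewrite e eqxx.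
- by rewrite (same _ _ _ e).
Qed.

Let residueA (j : 'I_p) : residue is_pole pole numer_poly (inl j) = coefA j.
Proof.
rewrite /residue big_sumType /= horner_numer_poly /coefA /cofactor /cofactor_den.
set t := j%:R + p%:R * (- r).
have -> : \prod_(i < p | (i < J.+1)%N && (inl i != inl j :> 'I_p + 'I_p)) (t - (i%:R + p%:R * (- r))) =
    \prod_(i < p | (i < J.+1)%N && (i != j :> nat)) (t - i%:R + p%:R * r).
  by apply: eq_big => [i //|i _]; ring.
have -> : \prod_(i < p | (k < i < m.+1)%N && (inr i != inl j :> 'I_p + 'I_p)) (t - (i%:R + p%:R * (- c))) =
    \prod_(i < p | (k < i < m.+1)%N) (t - i%:R + p%:R * c).
  by apply: eq_big => [i|i _]; [rewrite andbT | ring].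
rewrite (@prod_D1_if (fun i => (k < i < m.+1)%N) (fun i => t - i%:R + p%:R * c) j (ltn_ord j)) /=.
have -> : t - j%:R + p%:R * c = p%:R * (c - r) by rewrite /t; ring.
by rewrite !invfM; ring.
Qed.

Let residueB (j : 'I_p) : residue is_pole pole numer_poly (inr j) = coefB j.
Proof.
rewrite /residue big_sumType /= horner_numer_poly /coefB /cofactor /cofactor_den.
set t := j%:R + p%:R * (- c).
have -> : \prod_(i < p | (k < i < m.+1)%N && (inr i != inr j :> 'I_p + 'I_p)) (t - (i%:R + p%:R * (- c))) =
    \prod_(i < p | (k < i < m.+1)%N && (i != j :> nat)) (t - i%:R + p%:R * c).
  by apply: eq_big => [i //|i _]; ring.
have -> : \prod_(i < p | (i < J.+1)%N && (inl i != inr j :> 'I_p + 'I_p)) (t - (i%:R + p%:R * (- r))) =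
    \prod_(i < p | (i < J.+1)%N) (t - i%:R + p%:R * r).
  by apply: eq_big => [i|i _]; [rewrite andbT | ring].
rewrite (@prod_D1_if (fun i => (i < J.+1)%N) (fun i => t - i%:R + p%:R * r) j (ltn_ord j)) /=.
have -> : t - j%:R + p%:R * r = p%:R * (r - c) by rewrite /t; ring.
by rewrite !invfM; ring.
Qed.

Lemma ratfun_partial_fractions (n : nat) : ratfun n%:R =
  \sum_(j < p | (j < J.+1)%N) coefA j / (n%:R - j%:R + p%:R * r) +
  \sum_(j < p | (k < j < m.+1)%N) coefB j / (n%:R - j%:R + p%:R * c).
Proof.
have tz (s : 'I_p + 'I_p) : is_pole s -> n%:R != pole s.
  case: s => j _; rewrite -subr_eq0 /=.
    have -> : n%:R - (j%:R + p%:R * (- r)) = n%:R - j%:R + p%:R * r by ring.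
    exact: sub_add_pr_neq0.
  have -> : n%:R - (j%:R + p%:R * (- c)) = n%:R - j%:R + p%:R * c by ring.
  exact: sub_add_pc_neq0.
have := partial_fractions pole_inj size_numer_poly tz.
rewrite !big_sumType /= horner_numer_poly => E.
transitivity (numer n%:R /
  (\prod_(i < p | (i < J.+1)%N) (n%:R - (i%:R + p%:R * - r)) *
   \prod_(i < p | (k < i < m.+1)%N) (n%:R - (i%:R + p%:R * - c)))).
  by rewrite /ratfun /denA /denB; congr (_ / (_ * _)); apply: eq_bigr => i _; ring.
rewrite E; congr (_ + _); apply: eq_bigr => j _.
  by rewrite residueA; congr (_ / _); ring.
by rewrite residueB; congr (_ / _); ring.
Qed.

Lemma sum_coefs :
  \sum_(j < p | (j < J.+1)%N) coefA j + \sum_(j < p | (k < j < m.+1)%N) coefB j = 0.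
Proof.
have := sum_residues pole_inj size_numer_poly; rewrite big_sumType /= => E; rewrite -[RHS]E.
by congr (_ + _); apply: eq_bigr => j _; rewrite ?residueA ?residueB.
Qed.

(** The part of the sum of [ratfun] over block [b] that comes from the terms with [a] different from
    the pole index [j]. *)
Definition harmonic_part (b : nat) : rat :=
  \sum_(j < p | (j < J.+1)%N) coefA j * shift_inv p j (b%:R + r) +
  \sum_(j < p | (k < j < m.+1)%N) coefB j * shift_inv p j (b%:R + c).

Let br_neq0 (b : nat) : b%:R + r != 0.
Proof. exact: (int_add_frac_neq0 b r01). Qed.

Let sum_pole (b : nat) (x : rat) (j : 'I_p) : b%:R + x != 0 ->
  \sum_(a < p) ((a + b * p)%:R - j%:R + p%:R * x)^-1 =
  (p%:R * (b%:R + x))^-1 + shift_inv p j (b%:R + x).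
Proof.
move=> bx; rewrite (bigD1 j) //= /shift_inv; congr (_ + _).
  by congr _^-1; rewrite natrD natrM; ring.
by apply: eq_bigr => a _; congr _^-1; rewrite natrD natrM; ring.
Qed.

(** The terms [a = j] give [p ((b + c) SA + (b + r) SB)], from which [SA + SB = 0] removes [b]. *)
Lemma sum_scaled_ratfun b : \sum_(a < p) scaled_ratfun a b =
  p%:R * (c * \sum_(j < p | (j < J.+1)%N) coefA j +
          r * \sum_(j < p | (k < j < m.+1)%N) coefB j) +
  p%:R ^+ 2 * ((b%:R + r) * (b%:R + c) * harmonic_part b).
Proof.
have br := br_neq0 b; have bc := c_neq0 b.
pose SA := \sum_(j < p | (j < J.+1)%N) coefA j.
pose SB := \sum_(j < p | (k < j < m.+1)%N) coefB j.
pose HA := \sum_(j < p | (j < J.+1)%N) coefA j * shift_inv p j (b%:R + r).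
pose HB := \sum_(j < p | (k < j < m.+1)%N) coefB j * shift_inv p j (b%:R + c).
have sA : \sum_(a < p) \sum_(j < p | (j < J.+1)%N) coefA j / ((a + b * p)%:R - j%:R + p%:R * r) =
    SA / (p%:R * (b%:R + r)) + HA.
  rewrite exchange_big /= /SA /HA mulr_suml -big_split /=; apply: eq_bigr => j _.
  by rewrite -mulr_sumr sum_pole // mulrDr.
have sB : \sum_(a < p) \sum_(j < p | (k < j < m.+1)%N) coefB j / ((a + b * p)%:R - j%:R + p%:R * c) =
    SB / (p%:R * (b%:R + c)) + HB.
  rewrite exchange_big /= /SB /HB mulr_suml -big_split /=; apply: eq_bigr => j _.
  by rewrite -mulr_sumr sum_pole // mulrDr.
have -> : \sum_(a < p) scaled_ratfun a b = p%:R * (b%:R + r) * (p%:R * (b%:R + c)) *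
    (SA / (p%:R * (b%:R + r)) + HA + (SB / (p%:R * (b%:R + c)) + HB)).
  rewrite -sA -sB -big_split /= mulr_sumr; apply: eq_bigr => a _.
  by rewrite /scaled_ratfun ratfun_partial_fractions.
rewrite /harmonic_part -/SA -/SB -/HA -/HB.
have -> : SB = - SA by apply/eqP; rewrite -addr_eq0 addrC sum_coefs.
by field; rewrite br bc p_neq0.
Qed.

Let pint_b_add (b : nat) x : pint x -> pint (b%:R + x).
Proof. by move=> px; rewrite pintD ?pint_nat. Qed.

Lemma pint_harmonic_part b : pint (harmonic_part b / p%:R).
Proof.
rewrite /harmonic_part big_mkcond [X in _ + X]big_mkcond -big_split mulr_suml /=.
apply: (pint_sum p_prime) => j _; have jp := ltn_ord j.
have pbr := pint_b_add b pint_r; have pbc := pint_b_add b pint_c.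
have pNr := pintN pint_r; have pNc := pintN pint_c.
have pGA := pint_cofactor jp pNr; have pGB := pint_cofactor jp pNc.
have ph x (px : pint x) := red_dvd p_prime (pint_shift_inv p_prime jp px)
  (red_shift_inv p_prime p_gt3 jp px).
case: ifP => jA; case: ifP => jB.
- rewrite /coefA /coefB jA jB; set GA := cofactor _ _ in pGA *.
  set GB := cofactor _ _ in pGB *.
  have [w pw e] := shift_inv_diff p_prime p_gt3 jp pbr pbc.
  have pg : pint ((GA - GB) / p%:R).
    apply: (red_dvd p_prime); first exact: pintB.
    by rewrite (redB p_prime pGA pGB) !red_cofactorE // subrr.
  have cr0 := red_neq0 red_rc; have pcr := pintB p_prime pint_c pint_r.
  have rc0 : r - c != 0 by rewrite -opprB oppr_eq0.
  (* Both coefficients carry a denominator [p], with opposite signs. Split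
     [GA s - GB s' = (GA - GB) s + GB (s - s')]: [p] divides [GA - GB] and [s], and [p^2] divides
     [s - s']. *)
  have -> : (GA / (p%:R * (c - r)) * shift_inv p j (b%:R + r) +
      GB / (p%:R * (r - c)) * shift_inv p j (b%:R + c)) / p%:R =
    ((GA - GB) / p%:R * (shift_inv p j (b%:R + r) / p%:R) + GB * w) / (c - r).
    have -> : GB * w = GB * (shift_inv p j (b%:R + r) - shift_inv p j (b%:R + c)) / p%:R ^+ 2.
      by rewrite e; field.
    by field; rewrite p_neq0 cr0 rc0.
  exact: (pintM p_prime (pintD p_prime (pintM p_prime pg (ph _ pbr)) (pintM p_prime pGB pw))
    (pintV p_prime pcr red_rc)).
- rewrite addr0 /coefA jB divr1 -mulrA; exact: (pintM p_prime pGA (ph _ pbr)).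
- rewrite add0r /coefB jA divr1 -mulrA; exact: (pintM p_prime pGB (ph _ pbc)).
- by rewrite addr0 mul0r pint0.
Qed.

(** The part free of [b] drops out, and [p^2] times a harmonic part is divisible by [p^3]. *)
Lemma sum_scaled_ratfun_congr b :
  pint ((\sum_(a < p) scaled_ratfun a b - \sum_(a < p) scaled_ratfun a 0) / p%:R ^+ 3).
Proof.
have [h0 hb] := (pint_harmonic_part 0, pint_harmonic_part b).
rewrite !sum_scaled_ratfun.
set SA := \sum_(_ < _ | _) coefA _; set SB := \sum_(_ < _ | _) coefB _.
rewrite (_ : _ / _ = (b%:R + r) * (b%:R + c) * (harmonic_part b / p%:R) -
  (0%:R + r) * (0%:R + c) * (harmonic_part 0 / p%:R)); last by field.
apply: (pintB p_prime); apply: (pintM p_prime) => //; apply: (pintM p_prime); exact: pint_b_add.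
Qed.

Lemma scaled_ratfun_red a b : (a < p)%N ->
  pint (scaled_ratfun a b) /\ red (scaled_ratfun a b) = red (scaled_ratfun a 0).
Proof.
move=> ap; rewrite !scaled_ratfunE //.
pose ind (C : bool) : 'F_p := if C then 1 else 0.
have h x b' (C : bool) : pint x ->
    pint (if C then 1 else p%:R * (b'%:R + x)) /\
    red (if C then 1 else p%:R * (b'%:R + x)) = ind C.
  move=> px; case: C; first by rewrite pint1 red1.
  by rewrite pint_py ?red_py ?pint_b_add.
have [p1 r1] := h r b (a < J.+1)%N pint_r; have [p2 r2] := h c b (k < a < m.+1)%N pint_c.
have [p3 r3] := h r 0%N (a < J.+1)%N pint_r; have [p4 r4] := h c 0%N (k < a < m.+1)%N pint_c.
have pb := pint_nat p b; have p0 := pint_nat p 0.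
have pg := pint_cofactor ap pb; have pg0 := pint_cofactor ap p0.
have q1 := pintM p_prime pg p1; have q3 := pintM p_prime pg0 p3.
split; first exact: pintM.
rewrite (redM p_prime q1 p2) (redM p_prime q3 p4) (redM p_prime pg p1) (redM p_prime pg0 p3).
by rewrite r1 r2 r3 r4 !red_cofactorE.
Qed.

(** * The congruence for one block *)

Definition block_unit : rat := cofactor 0 (0%:R + p%:R * 0%:R) * c.

Lemma block_unitE : block_unit = p%:R * r * c * ratfun 0%:R.
Proof.
have E := @scaled_ratfunE 0 0 (prime_gt0 p_prime); rewrite /scaled_ratfun /= mul0n addn0 in E.
rewrite mulr1 in E; apply: (mulfI p_neq0).
transitivity (cofactor 0 (0%:R + p%:R * 0%:R) * (p%:R * (0%:R + c))).
  by rewrite /block_unit; ring.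
by rewrite -E; ring.
Qed.

(** At [a = 0] the numerator reduces to the product of [1, ..., J] and [k+2, ..., m], all below
    [p]. *)
Lemma block_unit_red : pint block_unit /\ red block_unit != 0.
Proof.
have p0 := prime_gt0 p_prime; have pz := pint_nat p 0.
have [pg rg] := cofactor_red p0 pz.
rewrite /block_unit (pintM p_prime pg pint_c) (redM p_prime pg pint_c) rg; split=> //.
rewrite mulf_neq0 // /red_cofactor mulf_neq0 ?invr_eq0 ?red_cofactor_den_neq0 //.
by rewrite mulf_neq0 //; apply/prodf_neq0 => i _; rewrite -natrD natF_eq0 // gtnNdvd //;
  have := ltn_ord i; nat_lia.
Qed.

(** The factor [(b + r)(b + c)] from [prod_error] goes into [scaled_ratfun] at the cost of [p^2] on
    the left; one [p] of it makes [ratfun 0] into the unit. *)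
Lemma term_block (a b : nat) : (a < p)%N ->
  p%:R * term (a + b * p) * block_unit =
  term b * (scaled_ratfun a b * excess a b * unit_part (a + b * p)).
Proof.
move=> ap; have := term_ratfun (a + b * p); rewrite prod_error //.
have r0 : r != 0 := red_neq0 red_r; have c0 : c != 0 := red_neq0 red_c.
rewrite block_unitE /scaled_ratfun; set T := term _; set R0 := ratfun 0%:R.
set E := excess a b; set U := unit_part _; set R := ratfun _; set tb := term b => e.
transitivity (p%:R ^+ 2 * r * c * (T * R0)); first by ring.
by rewrite e; field; rewrite r0 c0.
Qed.

Let pint_p (n : nat) : pint (p%:R ^+ n).
Proof. by rewrite pintX ?pint_nat. Qed.

Let pint_unit_part n : pint (unit_part n).
Proof.
have [S [pS -> _]] := unit_part_congr n.
exact: (pintD p_prime (pint1 p) (pintM p_prime pint_p2 pS)).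
Qed.

Lemma excess_low a b : (a <= m)%N -> excess a b = 1.
Proof. by rewrite /excess => ->. Qed.

Let pint_b_half (b : nat) : pint (b%:R + 1 / 2).
Proof. exact: pint_b_add. Qed.

(** Neither range contains [a], so [p (b + r)] and [p (b + c)] both stay, and the cofactor supplies
    the third [p]. [excess] cancels [b + c] and brings in [b + 1 - c]. *)
Lemma scaled_excess_high a b : (m < a < p)%N ->
  scaled_ratfun a b * excess a b =
  p%:R ^+ 3 * ((cofactor a (a%:R + p%:R * b%:R) / p%:R) * (b%:R + r) *
               (b%:R + 1 / 2) ^+ 2) / (b%:R + 1 - c).
Proof.
case/andP=> ma ap; rewrite scaled_ratfunE // /excess [(a <= m)%N]leqNgt ma /=.
have -> : (a < J.+1)%N = false by apply/negbTE; nat_lia.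
have -> : (k < a < m.+1)%N = false by apply/negbTE; nat_lia.
have b0 := c_neq0 b; have b1 := mc_neq0 b.
by field; rewrite b0 b1 p_neq0.
Qed.

Lemma pint_cofactor_high a b : (m < a < p)%N ->
  pint (cofactor a (a%:R + p%:R * b%:R) / p%:R).
Proof.
move=> mp; have /andP[_ ap] := mp; have pb := pint_nat p b.
by rewrite (red_dvd p_prime) ?pint_cofactor // red_cofactorE // red_cofactor_eq0.
Qed.

Lemma scaled_high a b : (m < a < p)%N -> exists2 w, pint w & scaled_ratfun a b = p%:R ^+ 3 * w.
Proof.
move=> mp; have pg := pint_cofactor_high b mp; have /andP[ma ap] := mp.
exists (cofactor a (a%:R + p%:R * b%:R) / p%:R * (b%:R + r) * (b%:R + c)).
  rewrite (pintM p_prime) ?pint_b_add // (pintM p_prime) ?pint_b_add //.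
rewrite scaled_ratfunE //.
have -> : (a < J.+1)%N = false by apply/negbTE; nat_lia.
have -> : (k < a < m.+1)%N = false by apply/negbTE; nat_lia.
by field.
Qed.

Let pint_1cV : pint (0%:R + 1 - c)^-1.
Proof. by rewrite add0r pintV ?pintB ?pint1. Qed.

(** The change made by the correction factors; the sum of [scaled_ratfun] alone is treated by
    partial fractions. *)
Let block_excess a b := scaled_ratfun a b * excess a b * unit_part (a + b * p) - scaled_ratfun a b.

(** For [a <= m] the difference is [p^2 (X S - X0 S0)], and neither [X] nor [S] depends on [b]
    modulo [p]. For [a > m] every term has [p^3], but [b + 1 - c] may be divisible by [p] and stays
    a denominator. *)
Lemma block_excess_congr a b : (a < p)%N -> exists th : rat * rat,
  [/\ pint th.1, pint th.2 &
      block_excess a b - block_excess a 0 =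
      p%:R ^+ 3 * th.1 + p%:R ^+ 3 * th.2 / (b%:R + 1 - c)].
Proof.
move=> ap; rewrite /block_excess; have [am|ma] := leqP a m.
  rewrite !excess_low // !mulr1.
  have [S [pS -> rS]] := unit_part_congr (a + b * p).
  have [S0 [pS0 -> rS0]] := unit_part_congr (a + 0 * p).
  rewrite sum_unit_slope_period in rS; rewrite sum_unit_slope_period in rS0.
  have [pX rX] := scaled_ratfun_red b ap; have [pX0 _] := scaled_ratfun_red 0 ap.
  set X := scaled_ratfun a b in pX rX *; set X0 := scaled_ratfun a 0 in pX0 rX *.
  have pd := pintB p_prime (pintM p_prime pX pS) (pintM p_prime pX0 pS0).
  have w : pint ((X * S - X0 * S0) / p%:R).
    apply: (red_dvd p_prime pd).
    rewrite (redB p_prime (pintM p_prime pX pS) (pintM p_prime pX0 pS0)).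
    by rewrite (redM p_prime pX pS) (redM p_prime pX0 pS0) rX rS rS0 subrr.
  exists ((X * S - X0 * S0) / p%:R, 0); split=> //=.
  by rewrite mulr0 mul0r addr0; field.
have mp : (m < a < p)%N by rewrite ma ap.
rewrite !scaled_excess_high //.
have [w pw ->] := scaled_high b mp; have [w0 pw0 ->] := scaled_high 0 mp.
have pU := pint_unit_part (a + b * p); have pU0 := pint_unit_part (a + 0 * p).
set U := unit_part _ in pU *; set U0 := unit_part _ in pU0 *.
have pG b' : pint (cofactor a (a%:R + p%:R * b'%:R) / p%:R * (b'%:R + r) *
               (b'%:R + 1 / 2) ^+ 2).
  have pg := pint_cofactor_high b' mp.
  by rewrite (pintM p_prime) ?(pintX p_prime) // (pintM p_prime) ?pint_b_add.
have pg := pG b; have pg0 := pG 0%N.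
set G := _ * _ * _ ^+ 2 in pg *; set G0 := _ * _ * _ ^+ 2 in pg0 *.
(* For block [0] the denominator [1 - c] is a unit, so its share goes into the integral part. *)
exists (w0 - w - G0 / (0%:R + 1 - c) * U0, G * U); split=> /=.
- exact: (pintB p_prime (pintB p_prime pw0 pw)
    (pintM p_prime (pintM p_prime pg0 pint_1cV) pU0)).
- exact: pintM.
- have b1 := mc_neq0 b; have b2 := mc_neq0 0.
  rewrite add0r in b2 *; by field; rewrite b1 b2.
Qed.

(** Sum [term_block] over [a], compare with block [0], where [term 0 = 1], and divide by the
    unit. *)
Lemma block_congr b : exists th th' : rat, [/\ pint th, pint th' &
  p%:R * \sum_(a < p) term (a + b * p) =
  term b * (p%:R * (\sum_(a < p) term a) + p%:R ^+ 3 * th +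
            p%:R ^+ 3 * th' / (b%:R + 1 - c))].
Proof.
have [pQ rQ] := block_unit_red; have Q0 := red_neq0 rQ; have pQV := pintV p_prime pQ rQ.
have [f Hf] := fin_all_exists (fun a : 'I_p => block_excess_congr b (ltn_ord a)).
have sumE b' : p%:R * (\sum_(a < p) term (a + b' * p)) * block_unit =
    term b' * (\sum_(a < p) scaled_ratfun a b' + \sum_(a < p) block_excess a b').
  rewrite -big_split mulr_sumr mulr_suml mulr_sumr; apply: eq_bigr => a _ /=.
  by rewrite term_block // /block_excess; ring.
have E0 : p%:R * (\sum_(a < p) term a) * block_unit =
    \sum_(a < p) scaled_ratfun a 0 + \sum_(a < p) block_excess a 0.
  have := sumE 0%N; rewrite term0 mul1r => <-.
  by congr (_ * _ * _); apply: eq_bigr => a _; rewrite mul0n addn0.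
have pw := sum_scaled_ratfun_congr b; set w := _ / _ in pw.
exists ((w + \sum_(a < p) (f a).1) / block_unit), ((\sum_(a < p) (f a).2) / block_unit).
split.
- rewrite (pintM p_prime) // (pintD p_prime) // (pint_sum p_prime) // => a _.
  by case: (Hf a).
- by rewrite (pintM p_prime) // (pint_sum p_prime) // => a _; case: (Hf a).
apply: (mulIf Q0); rewrite sumE.
have b1 := mc_neq0 b.
transitivity (term b * (p%:R * (\sum_(a < p) term a) * block_unit + p%:R ^+ 3 * (w + \sum_(a < p) (f a).1) +
    p%:R ^+ 3 * (\sum_(a < p) (f a).2) / (b%:R + 1 - c))); last first.
  by field; rewrite Q0 b1.
congr (_ * _).
have E1 : \sum_(a < p) block_excess a b = \sum_(a < p) block_excess a 0 +
   (p%:R ^+ 3 * (\sum_(a < p) (f a).1) + p%:R ^+ 3 * (\sum_(a < p) (f a).2) / (b%:R + 1 - c)).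
  rewrite !mulr_sumr mulr_suml -!big_split /=; apply: eq_bigr => a _.
  by have [_ _ <-] := Hf a; ring.
have E2 : \sum_(a < p) scaled_ratfun a b = \sum_(a < p) scaled_ratfun a 0 + p%:R ^+ 3 * w.
  by rewrite /w; field.
by rewrite E1 E2 E0; ring.
Qed.

(** * Integrality of the scaled summands *)

Lemma scaled_excess_form a b : (a < p)%N -> exists u v : rat, [/\ pint u, pint v &
  scaled_ratfun a b * excess a b = u + v / (b%:R + 1 - c)].
Proof.
move=> ap; have [am|ma] := leqP a m.
  have [pX _] := scaled_ratfun_red b ap.
  exists (scaled_ratfun a b), 0; rewrite pX pint0; split=> //.
  by rewrite excess_low // mulr1 mul0r addr0.
have mp : (m < a < p)%N by rewrite ma ap.
have pg := pint_cofactor_high b mp; rewrite scaled_excess_high //.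
set w := _ * _ * _ ^+ 2.
have pw : pint w.
  exact: (pintM p_prime (pintM p_prime pg (pint_b_add b pint_r)) (pintX p_prime 2 (pint_b_half b))).
exists 0, (p%:R ^+ 3 * w); rewrite pint0; split=> //; last by rewrite add0r.
exact: (pintM p_prime (pint_p 3) pw).
Qed.

Let form_scale a b x : (a < p)%N -> pint x -> exists u v : rat, [/\ pint u, pint v &
  scaled_ratfun a b * excess a b * x = u + v / (b%:R + 1 - c)].
Proof.
move=> ap px; have [u [v [pu pv ->]]] := scaled_excess_form b ap.
exists (u * x), (v * x); split; [exact: pintM|exact: pintM|].
by rewrite mulrDl mulrAC.
Qed.

Let cancel_mid (F : fieldType) (x y z w : F) : z != 0 -> x * (y * z) / w / z = x * y / w.
Proof. by move=> z0; rewrite mulrAC [x * _]mulrA mulfK. Qed.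

(* At this index the numerator contains the factor a + b p + 1 - c itself. *)
Lemma pint_cofactor_div a b : (a + k.+2 = p)%N ->
  pint (cofactor a (a%:R + p%:R * b%:R) / (p%:R * (b%:R + 1 - c))).
Proof.
move=> ak; have ap : (a < p)%N by nat_lia.
have pb := pint_nat p b; have [pd rd] := cofactor_den_red ap pb.
have d0 := red_cofactor_den_neq0 ap; rewrite -rd in d0; have pdV := pintV p_prime pd d0.
rewrite /cofactor /numer; set t := a%:R + _ in pd d0 pdV *.
have pt : pint t by exact: pint_shifted.
set z := p%:R * (b%:R + 1 - c).
have -> : t + k.+2%:R - p%:R * c = z.
  transitivity ((a%:R + k.+2%:R) + p%:R * b%:R - p%:R * c); first by rewrite /t; ring.
  by rewrite -natrD ak /z; ring.
have z0 : z != 0 by rewrite mulf_neq0 // mc_neq0.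
have [L ->] : exists L, (m - k.+1 = L.+1)%N by exists (m - k.+2)%N; nat_lia.
rewrite risingS -rising_shift; set D := cofactor_den _ _ in pdV *.
set N := rising _ J.
have -> : N * (rising (z + 1) L * z) / D / z = N * rising (z + 1) L * D^-1.
  exact: cancel_mid.
have pz : pint (z + 1).
  exact: (pintD p_prime (pint_py (pintB p_prime (pintD p_prime pb (pint1 p)) pint_c)) (pint1 p)).
have pn : pint (t + 1 - p%:R * r).
  exact: (pintB p_prime (pintD p_prime pt (pint1 p)) (pint_py pint_r)).
exact: (pintM p_prime (pintM p_prime (rising_red J pn).1 (rising_red L pz).1) pdV).
Qed.

(** If the divisor is not a unit, [ck] leaves one index: [a = p - k - 2] with divisor
    [p (b + 1 - c)], a factor of the cofactor's numerator, or [a = k] with divisor [p (b + c)], a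
    factor of [scaled_ratfun]. *)
Lemma scaled_excess_div_form a b : (a < p)%N -> exists u v : rat, [/\ pint u, pint v &
  scaled_ratfun a b * excess a b / ((a + b * p)%:R + 1 - c) = u + v / (b%:R + 1 - c)].
Proof.
move=> ap; have pb := pint_nat p b.
set x := (a + b * p)%:R + 1 - c.
have px : pint x.
  exact: (pintB p_prime (pintD p_prime (pint_nat p _) (pint1 p)) pint_c).
have [rx|rx] := eqVneq (red x) 0; last first.
  exact: (form_scale b ap (pintV p_prime px rx)).
case: ck => e.
- have xE : x = (a + k.+2)%:R + p%:R * (b%:R - c).
    rewrite /x !natrD natrM -[k.+2%:R]natr1 -[k.+1%:R]natr1; have -> : c = p%:R * c - k%:R - 1 by lra.
    have -> : p%:R * (b%:R - (p%:R * c - k%:R - 1)) = p%:R * b%:R - p%:R * c.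
      have -> : p%:R * c - k%:R - 1 = c by lra.
      ring.
    ring.
  have ak : (a + k.+2 = p)%N.
    have : (p %| a + k.+2)%N.
      by rewrite -(natF_eq0 p_prime) -(red_shifted (a + k.+2) (pintB p_prime pb pint_c)) -xE rx.
    (* The only multiple of [p] strictly between [0] and [2p] is [p]. *)
    case/dvdnP => q' q'e; have : (q' = 1)%N by case: q' q'e => [|[|q'']] q'e; nat_nia.
    by move=> q1; rewrite q'e q1 mul1n.
  have mp : (m < a < p)%N by rewrite ap andbT; nat_lia.
  have pg := pint_cofactor_div b ak.
  rewrite scaled_excess_high //.
  have x' : x = p%:R * (b%:R + 1 - c) by rewrite xE ak; ring.
  rewrite x'; have b1 := mc_neq0 b.
  set g := cofactor _ _ / (_ * _) in pg.
  exists 0, (p%:R ^+ 2 * (g * (b%:R + r) * (b%:R + 1 / 2) ^+ 2)); rewrite pint0; split=> //.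
    apply: (pintM p_prime (pint_p 2)).
    exact: (pintM p_prime (pintM p_prime pg (pint_b_add b pint_r)) (pintX p_prime 2 (pint_b_half b))).
  by rewrite /g; field; rewrite b1 p_neq0.
- have xE : x = a%:R - k%:R + p%:R * (b%:R + c).
    rewrite /x natrD natrM mulrDr.
    have -> : p%:R * c = 1 - c + k%:R by lra.
    ring.
  have kp : (k < p)%N by nat_lia.
  have ak : a = k.
    apply/eqP; apply: contraT => ak.
    have := red_shift_neq0 p_prime ap kp ak (pint_b_add b pint_c).
    by rewrite -xE rx eqxx.
  have pg := pint_cofactor ap pb.
  exists (cofactor a (a%:R + p%:R * b%:R)), 0; rewrite pint0; split=> //.
  rewrite xE ak subrr add0r excess_low; last by nat_lia.
  rewrite scaled_ratfunE // ltnn /= (_ : (k < J.+1)%N); last by nat_lia.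
  by have b0 := c_neq0 b; have b1 := mc_neq0 b; field; rewrite b0 b1 p_neq0.
Qed.

Lemma term_block_form a b : (a < p)%N -> exists u v : rat, [/\ pint u, pint v &
  p%:R * term (a + b * p) = term b * u + term b / (b%:R + 1 - c) * v].
Proof.
move=> ap; have [pQ rQ] := block_unit_red; have Q0 := red_neq0 rQ.
have [u [v [pu pv e]]] := scaled_excess_form b ap; have pU := pint_unit_part (a + b * p).
have pUQ := pintM p_prime pU (pintV p_prime pQ rQ).
exists (u * (unit_part (a + b * p) / block_unit)), (v * (unit_part (a + b * p) / block_unit)).
split; [exact: pintM|exact: pintM|].
apply: (mulIf Q0); rewrite term_block // e.
have b1 := mc_neq0 b.
by field; rewrite Q0 b1.
Qed.

Lemma term_block_div_form a b : (a < p)%N -> exists u v : rat, [/\ pint u, pint v &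
  p%:R * (term (a + b * p) / ((a + b * p)%:R + 1 - c)) =
  term b * u + term b / (b%:R + 1 - c) * v].
Proof.
move=> ap; have [pQ rQ] := block_unit_red; have Q0 := red_neq0 rQ.
have [u [v [pu pv e]]] := scaled_excess_div_form b ap; have pU := pint_unit_part (a + b * p).
have pUQ := pintM p_prime pU (pintV p_prime pQ rQ).
exists (u * (unit_part (a + b * p) / block_unit)), (v * (unit_part (a + b * p) / block_unit)).
split; [exact: pintM|exact: pintM|].
have b1 := mc_neq0 b; have b2 := mc_neq0 (a + b * p).
set x := (_%:R + 1 - c) in e b2 *.
apply: (mulIf Q0).
transitivity (p%:R * term (a + b * p) * block_unit / x); first by ring.
rewrite term_block //.
transitivity (term b * (scaled_ratfun a b * excess a b / x) * unit_part (a + b * p)); first by ring.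
by rewrite e; field; rewrite Q0 b1.
Qed.

(** Both claims go through one induction on [s]: each quantity at [a + b p], times [p], is an
    integral combination of both at [b]. *)
Lemma term_integral s b : (b < p ^ s)%N ->
  pint (p%:R ^+ s * term b) /\ pint (p%:R ^+ s * (term b / (b%:R + 1 - c))).
Proof.
elim: s b => [|s IH] n.
  rewrite expn0 ltnS leqn0 => /eqP ->; rewrite !expr0 !mul1r term0 pint1; split=> //.
  by rewrite mul1r pint_1cV.
rewrite expnSr => np; have p0 := prime_gt0 p_prime.
have nE : n = (n %% p + n %/ p * p)%N by rewrite addnC -divn_eq.
have ap : (n %% p < p)%N by rewrite ltn_pmod.
have bp : (n %/ p < p ^ s)%N by rewrite ltn_divLR.
move: (n %% p)%N (n %/ p)%N nE ap bp => a b -> ap /IH [h1 h2]; split.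
- have [u [v [pu pv e]]] := term_block_form b ap.
  rewrite exprSr -mulrA e.
  rewrite (_ : _ * _ = p%:R ^+ s * term b * u + p%:R ^+ s * (term b / (b%:R + 1 - c)) * v);
    last by ring.
  exact: (pintD p_prime (pintM p_prime h1 pu) (pintM p_prime h2 pv)).
- have [u [v [pu pv e]]] := term_block_div_form b ap.
  rewrite exprSr -mulrA e.
  rewrite (_ : _ * _ = p%:R ^+ s * term b * u + p%:R ^+ s * (term b / (b%:R + 1 - c)) * v);
    last by ring.
  exact: (pintD p_prime (pintM p_prime h1 pu) (pintM p_prime h2 pv)).
Qed.

(** * Summation over blocks *)

Lemma sum_blocks (V : nmodType) (f : nat -> V) B :
  \sum_(n < B * p) f n = \sum_(b < B) \sum_(a < p) f (a + b * p)%N.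
Proof.
elim: B => [|B IH]; first by rewrite mul0n !big_ord0.
rewrite mulSn addnC big_split_ord big_ord_recr /= IH; congr (_ + _).
by apply: eq_bigr => a _; rewrite addnC.
Qed.

(** Block [b] deviates by [p^3] times a combination of [term b] and [term b / (b + 1 - c)], which
    the factor [p^s] makes integral. *)
Lemma sum_term_congr s : padic_congr p 3
  (p%:R ^+ s.+1 * \sum_(n < p ^ s.+1) term n)
  (p%:R ^+ s * (\sum_(n < p ^ s) term n) * (p%:R * \sum_(n < p ^ 1) term n)).
Proof.
apply: (padic_congr_pint p_prime); rewrite expnSr sum_blocks expn1.
set F := \sum_(n < p) term n.
have -> : (p%:R ^+ s.+1 * (\sum_(b < p ^ s) \sum_(a < p) term (a + b * p)) -
    p%:R ^+ s * (\sum_(n < p ^ s) term n) * (p%:R * F)) / p%:R ^+ 3 =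
    \sum_(b < p ^ s) p%:R ^+ s * (p%:R * (\sum_(a < p) term (a + b * p)) - term b * (p%:R * F)) / p%:R ^+ 3.
  rewrite -mulr_suml -mulr_sumr sumrB -mulr_sumr -mulr_suml exprSr; ring.
apply: (pint_sum p_prime) => b _.
have [th [th' [pth pth' ->]]] := block_congr b; have [h1 h2] := term_integral (ltn_ord b).
have b1 := mc_neq0 b.
have -> : p%:R ^+ s * (term b * (p%:R * F + p%:R ^+ 3 * th + p%:R ^+ 3 * th' / (b%:R + 1 - c)) -
    term b * (p%:R * F)) / p%:R ^+ 3 =
    p%:R ^+ s * term b * th + p%:R ^+ s * (term b / (b%:R + 1 - c)) * th'.
  by move: (p%:R ^+ s) => P; field; rewrite b1 p_neq0.
exact: (pintD p_prime (pintM p_prime h1 pth) (pintM p_prime h2 pth')).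
Qed.

End Summand.

(** * The six parameter triples *)

Lemma red_natdiv p (a b : nat) : prime p -> ~~ (p %| a)%N -> ~~ (p %| b)%N ->
  pint p (a%:R / b%:R) /\ red p (a%:R / b%:R) != 0.
Proof.
move=> pp pa pb; have rb : red p b%:R != 0 by rewrite red_nat natF_eq0.
have pV := pintV pp (pint_nat p b) rb.
split; first exact: (pintM pp (pint_nat p a) pV).
rewrite (redM pp (pint_nat p a) pV) (redV pp (pint_nat p b) rb) mulf_neq0 ?invr_neq0 //.
by rewrite red_nat natF_eq0.
Qed.

(** The only units modulo [2], [3], [4], [6] are [1] and [-1]; the two cases make [p/e - J] equal to
    [1/e] or [1 - 1/e]. *)
Lemma index_of_residue (p e : nat) : ~~ (2 %| p)%N -> ~~ (3 %| p)%N -> (7 <= p)%N ->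
  e \in [:: 2; 3; 4; 6] ->
  exists J : nat, (e * J + 1 = p)%N \/ (e * J + e = p + 1)%N.
Proof.
move=> p2 p3 p7; rewrite !inE => /or4P [] /eqP ->.
- by exists (p %/ 2)%N; lia.
- by exists ((p - 1) %/ 3)%N; lia.
- by exists ((p - 1) %/ 4)%N; lia.
- by exists ((p - 1) %/ 6)%N; lia.
Qed.

Lemma sum_term_congr_inv (p e d : nat) : prime p -> (7 <= p)%N ->
  e \in [:: 2; 3; 4] -> d \in [:: 3; 4; 6] -> (e < d)%N -> forall s,
  padic_congr p 3
  (p%:R ^+ s.+1 * \sum_(n < p ^ s.+1) term (1 / e%:R) (1 / d%:R) n)
  (p%:R ^+ s * (\sum_(n < p ^ s) term (1 / e%:R) (1 / d%:R) n) *
   (p%:R * \sum_(n < p ^ 1) term (1 / e%:R) (1 / d%:R) n)).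
Proof.
move=> pp p7 he hd ed s.
have p2 : ~~ (2 %| p)%N by rewrite dvdn_prime2 //; lia.
have p3 : ~~ (3 %| p)%N by rewrite dvdn_prime2 //; lia.
have he' : e \in [:: 2; 3; 4; 6] by move: he; rewrite !inE => /or3P [] ->; rewrite ?orbT.
have hd' : d \in [:: 2; 3; 4; 6] by move: hd; rewrite !inE => /or3P [] ->; rewrite ?orbT.
have [J eJ] := index_of_residue p2 p3 p7 he'.
have [k' dk'] := index_of_residue p2 p3 p7 hd'.
(* For [p] congruent to [1] modulo [d], the index is one below the integer part of [p/d], so that
   [p c - k = 1 + c]. *)
have [k dk] : exists k : nat, (d * k + d + 1 = p)%N \/ (d * k + d = p + 1)%N.
  case: dk' => [h|h]; last by exists k'; right.
  case: k' h => [|k'] h; first by move: p7; rewrite -h muln0.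
  by exists k'; left; rewrite -h mulnS (addnC d).
have [e2 e4] : (1 < e /\ e < 7)%N by move: he; rewrite !inE => /or3P [] /eqP ->.
have [d2 d6] : (1 < d /\ d < 7)%N by move: hd; rewrite !inE => /or3P [] /eqP ->.
have pm : p = p./2.*2.+1 by lia.
have kJ : (k < J)%N.
  move: ed eJ dk; move: he hd; rewrite !inE.
  by move=> /or3P [] /eqP -> /or3P [] /eqP -> // _ eJ dk; clear -eJ dk p7; lia.
have Jm : (J <= p./2)%N.
  by move: eJ; move: he; rewrite !inE => /or3P [] /eqP -> eJ; clear -eJ p7; lia.
have km : (k.+2 <= p./2)%N.
  by move: dk; move: hd; rewrite !inE => /or3P [] /eqP -> dk; clear -dk p7; lia.
have p_gt3 : (3 < p)%N by apply: leq_trans p7.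
have de0 : (0 < d - e < 7)%N by rewrite subn_gt0 ed (leq_ltn_trans (leq_subr _ _)).
have d1 : (0 < d - 1 < 7)%N by rewrite subn_gt0 d2 (leq_ltn_trans (leq_subr _ _)).
have e07 : (0 < e < 7)%N by rewrite (ltnW e2).
have d07 : (0 < d < 7)%N by rewrite (ltnW d2).
(* Makes [e], [d], [d - 1] and [d - e] units at [p], as the hypotheses on [r], [c], [1 - c] and
   [c - r] require. *)
have small n : (0 < n < 7)%N -> ~~ (p %| n)%N.
  by case/andP=> n0 n7; rewrite gtnNdvd // (leq_trans n7).
have de : ~~ (p %| d * e)%N by rewrite Euclid_dvdM // negb_or !small.
have e0 : e%:R != 0 :> rat by rewrite pnatr_eq0 -lt0n ltnW.
have d0 : d%:R != 0 :> rat by rewrite pnatr_eq0 -lt0n ltnW.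
have [pe re] := red_natdiv pp (small 1 isT) (small e e07).
have [pd rd] := red_natdiv pp (small 1 isT) (small d d07).
have [p1 r1] := red_natdiv pp (small (d - 1)%N d1) (small d d07).
have [p4 r4] := red_natdiv pp (small (d - e)%N de0) de.
apply: (@sum_term_congr p p./2 J k) => //.
- by rewrite mul1r invr_gt0 ltr0n  (ltnW e2) invf_lt1 ?ltr0n ?(ltnW e2) // ltr1n.
- by rewrite mul1r invr_gt0 ltr0n  (ltnW d2) invf_lt1 ?ltr0n ?(ltnW d2) // ltr1n.
- have [h|h] := eJ; [left|right].
    by rewrite -[in LHS]h natrD natrM; field.
  have -> : p%:R = e%:R * J%:R + e%:R - 1 :> rat by rewrite -natrM -natrD h natrD addrK.
  by field.
- have [h|h] := dk; [left|right].
    by rewrite -[in LHS]h !natrD natrM; field.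
  have -> : p%:R = d%:R * k%:R + d%:R - 1 :> rat by rewrite -natrM -natrD h natrD addrK.
  by field.
- have -> : 1 / d%:R - 1 / e%:R = - ((d - e)%:R / (d * e)%:R) :> rat.
    by rewrite natrB ?(ltnW ed) // natrM; field; rewrite d0 e0.
  by rewrite (redN pp p4) oppr_eq0.
- have -> : 1 - 1 / d%:R = (d - 1)%:R / d%:R :> rat.
    by rewrite natrB; [field | exact: ltnW].
  exact: r1.
Qed.

Lemma trunc_hyp_term p s r c :
  trunc_hyp p s [tuple 1 / 2; 1 - 1 / 2; r; 1 - r] [tuple 1; 1; 1 + c; 2 - (1 + c)] =
  \sum_(n < p ^ s) term r c n.
Proof.
apply: eq_bigr => n _; rewrite /term !big_cons !big_nil !mulr1 !mulrA.
have -> : 1 - 1 / 2 = 1 / 2 :> rat by field.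
by have -> : 2 - (1 + c) = 1 - c by ring.
Qed.

Theorem theorem1p4 (p : nat) (r1 r2 q : rat)
    (alpha := [tuple r1; 1 - r1; r2; 1 - r2])
    (beta := [tuple 1; 1; q; 2 - q]) :
  prime p -> (7 <= p)%N -> (r1, r2, q) \in hyp_params ->
  forall s : nat,
    padic_congr p 3
      (p%:R ^+ s.+1 * trunc_hyp p s.+1 alpha beta)
      ((p%:R ^+ s * trunc_hyp p s alpha beta) *
       (p%:R * trunc_hyp p 1 alpha beta)).
Proof.
move=> pp p7 h s; rewrite /alpha /beta.
(* Every triple has the form [r1 = 1/2], [r2 = 1/e], [q = 1 + 1/d] with [e < d]. *)
have [[e d] /and3P[/= he hd ed] [-> -> ->]] : exists2 ed : nat * nat,
    [&& ed.1 \in [:: 2; 3; 4], ed.2 \in [:: 3; 4; 6] & (ed.1 < ed.2)%N] &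
    (r1, r2, q) = (1 / 2, 1 / ed.1%:R, 1 + 1 / ed.2%:R).
  move: h; rewrite !inE; do ![case/orP]; move=> /eqP [-> -> ->].
  - by exists (2, 3).
  - by exists (2, 6).
  - by exists (3, 6).
  - by exists (3, 4).
  - by exists (4, 6).
  - by exists (2, 4).
rewrite !trunc_hyp_term; exact: sum_term_congr_inv.
Qed.
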